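(* There is a universal constant $C>0$ such that for all sufficiently large integers $n$, $$\mathrm{stretch}(n)\le C\cdot \log n\cdot \log\log n\cdot(\log\log\log n)^3 .$$ Here $$\mathrm{stretch}(n)=\sup_{G=(V,E),\ |V|=n}\ \inf_{\mathcal T}\ \max_{(u,v)\in E}\ \mathbb{E}_{T\sim\mathcal T}\!\left[\frac{d_T(u,v)}{d_G(u,v)}\right],$$ where $G$ ranges over finite connected graphs on $n$ vertices with positive edge lengths, and $\mathcal T$ ranges over probability distributions over spanning trees of $G$.
   Context: Graphs are finite, undirected and connected, with positive edge lengths (an unweighted graph has all lengths $1$). For a connected graph or subgraph $H$, $d_H$ denotes the shortest path metric of $H$. A spanning tree $T$ of $G$ is a subgraph of $G$, with the edge lengths inherited from $G$. Logarithms are to base $2$. *)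

(* Defs.v *)
From HB Require Import structures.
From mathcomp Require Import all_boot all_order all_algebra.
From mathcomp Require Import all_classical all_reals all_analysis.

Set Implicit Arguments.
Unset Strict Implicit.
Unset Printing Implicit Defensive.

Import Order.TTheory GRing.Theory Num.Theory.

Local Open Scope classical_set_scope.
Local Open Scope ring_scope.

(* An undirected edge is the finite set of its two endpoints, so that a
   spanning subgraph on the vertex type V is a value of {set {set V}}. *)
Definition edge (V : finType) (u v : V) : {set V} := [set u; v]%SET.

Definition adj (V : finType) (F : {set {set V}}) : rel V :=
  fun u v => edge u v \in F.

Definition connected_graph (V : finType) (F : {set {set V}}) : Prop :=
  forall u v : V, connect (adj F) u v.

(* ucycle also accepts [:: u; v] for a single edge uv, hence the bound 2. *)
Definition acyclic_graph (V : finType) (F : {set {set V}}) : Prop :=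
  forall c : seq V, ucycle (adj F) c -> (size c <= 2)%N.

Record wgraph (R : realType) (V : finType) := WGraph {
  edges : {set {set V}};
  len : {set V} -> R;
  card_edges : forall e, e \in edges -> #|e| = 2%N;
  len_gt0 : forall e, e \in edges -> 0 < len e;
  edges_connected : connected_graph edges
}.

(* Length of the walk visiting u and then, in order, the vertices of p. *)
Definition walk_len (R : realType) (V : finType) (l : {set V} -> R)
    (u : V) (p : seq V) : R :=
  \sum_(e <- pairmap (@edge V) u p) l e.

(* Shortest path metric d_H of the subgraph H of G with edge set F. The
   infimum is real-valued, and is 0 by convention when v is not reachable
   from u; it is only used for connected H. *)
Definition dist (R : realType) (V : finType) (G : wgraph R V)
    (F : {set {set V}}) (u v : V) : R :=
  inf [set x : R | exists p : seq V,
    [/\ path (adj F) u p, last u p = v & x = walk_len (len G) u p]].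

Definition spanning_tree (R : realType) (V : finType) (G : wgraph R V)
    (T : {set {set V}}) : Prop :=
  [/\ T \subset edges G, connected_graph T & acyclic_graph T].

Definition tree_distribution (R : realType) (V : finType) (G : wgraph R V)
    (P : {ffun {set {set V}} -> R}) : Prop :=
  [/\ forall T, 0 <= P T,
      \sum_T P T = 1
    & forall T, P T != 0 -> spanning_tree G T].

Definition expected_stretch (R : realType) (V : finType) (G : wgraph R V)
    (P : {ffun {set {set V}} -> R}) (u v : V) : R :=
  \sum_T P T * (dist G T u v / dist G (edges G) u v).

(* The default value 0 only matters when G has no edge, i.e. #|V| <= 1. *)
Definition max_stretch (R : realType) (V : finType) (G : wgraph R V)
    (P : {ffun {set {set V}} -> R}) : R :=
  \big[Num.max/0]_(uv : V * V | adj (edges G) uv.1 uv.2)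
    expected_stretch G P uv.1 uv.2.

Definition graph_stretch (R : realType) (V : finType) (G : wgraph R V) : \bar R :=
  ereal_inf [set x : \bar R | exists2 P : {ffun {set {set V}} -> R},
    tree_distribution G P & x = (max_stretch G P)%:E].

Definition stretch (R : realType) (n : nat) : \bar R :=
  ereal_sup [set x : \bar R | exists (V : finType) (G : wgraph R V),
    #|V| = n /\ x = graph_stretch G].

Definition log2 (R : realType) (x : R) : R := ln x / ln 2.

(* Main.v *)
(* Abraham and Neiman's petal decomposition, one petal at a time.

   By the minimax theorem it suffices to find, for every weighting c of the
   edges, one spanning tree of small c-average stretch.  The tree is built by
   recursion on a cluster Y with root x0 and a "highway" h, a shortest path of
   G[Y] from x0 whose edges have had their lengths halved.  Let delta be the
   distance from x0 and Delta its maximum.  A petal A = {sigma >= D} is cut off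
   around a shortest path q from x0: either q = h, and the tail of the highway
   goes to the petal, or the end of h is closer than 3/4 Delta and q leads to a
   farthest vertex, in which case the part of q in A becomes the halved highway
   of A.  With y x the edge on which q enters A, distances from x0 in Y \ A are
   unchanged, and walking through y x to a point z of A loses nothing that the
   halving does not repay; as every edge is halved at most once, the true tree
   distance from x0 to z is at most 4 delta z, and at most twice the halved
   length on the highway.  So an edge cut by A has tree distance at most
   8 Delta, while D is free in a window of width Delta / 4.  Region growing
   picks D such that the cut is paid for, up to a factor L ~ log log n, by the
   decrease of the potential mass(Y) log mass(Y).  This yields expected stretch
   O(log n log log n). *)

Require Import Defs.
From mathcomp Require Import all_boot all_order all_algebra.
From mathcomp Require Import all_classical all_reals all_analysis.
From mathcomp Require Import fintype finset lra ring.

Set Implicit Arguments.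
Unset Strict Implicit.
Unset Printing Implicit Defensive.

Import Order.TTheory GRing.Theory Num.Theory.
Local Open Scope ring_scope.

(** * Walks, shortest path distances and induced subgraphs *)

Section Walks.
Context {R : realType} {V : finType}.
Implicit Types (F : {set {set V}}) (l : {set V} -> R) (u v w : V) (p q : seq V).

Lemma edgeC u v : edge u v = edge v u.
Proof. by rewrite /edge setUC. Qed.

Lemma adjC F : symmetric (adj F).
Proof. by move=> u v; rewrite /adj edgeC. Qed.

Lemma walk_len_nil l u : walk_len l u [::] = 0.
Proof. by rewrite /walk_len big_nil. Qed.

Lemma walk_len_cons l u v p :
  walk_len l u (v :: p) = l (edge u v) + walk_len l v p.
Proof. by rewrite /walk_len big_cons. Qed.

Lemma walk_len_cat l u p q :
  walk_len l u (p ++ q) = walk_len l u p + walk_len l (last u p) q.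
Proof.
elim: p u => [|v p IH] u /=; first by rewrite walk_len_nil add0r.
by rewrite !walk_len_cons IH addrA.
Qed.

Lemma walk_len_rev l u p :
  walk_len l (last u p) (rev (belast u p)) = walk_len l u p.
Proof.
elim: p u => [|v p IH] u //=.
have e : last (last v p) (rev (belast v p)) = v.
  by case: p {IH} => [|w p] //=; rewrite rev_cons last_rcons.
rewrite rev_cons -cats1 walk_len_cat IH e !walk_len_cons walk_len_nil addr0.
by rewrite addrC edgeC.
Qed.

Lemma mem_pairmap_edge F u p e :
  path (adj F) u p -> e \in pairmap (@edge V) u p -> e \in F.
Proof.
elim: p u => [|v p IH] u //= /andP[uv pp].
by rewrite in_cons => /predU1P[->//|/IH]; apply.
Qed.

Lemma pairmap_edge_sub u p e :
  e \in pairmap (@edge V) u p -> e \subset (u :: p).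
Proof.
elim: p u => [|v p IH] u //=.
rewrite in_cons => /predU1P[->|/IH].
  by apply/subsetP => w; rewrite /edge !inE => /orP[] ->; rewrite ?orbT.
by move=> /subset_trans; apply; apply/subsetP => w wp; rewrite inE wp orbT.
Qed.

Lemma eq_walk_len F l l' u p : path (adj F) u p ->
  {in F, l =1 l'} -> walk_len l u p = walk_len l' u p.
Proof.
move=> pp ll'; rewrite /walk_len; apply: eq_big_seq => e /(mem_pairmap_edge pp).
exact: ll'.
Qed.

Lemma le_walk_len F l l' u p : path (adj F) u p ->
  (forall e, e \in F -> l e <= l' e) -> walk_len l u p <= walk_len l' u p.
Proof.
move=> pp ll'; rewrite /walk_len big_seq [leRHS]big_seq.
by apply: ler_sum => e /(mem_pairmap_edge pp); apply: ll'.
Qed.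

Lemma walk_len_ge0 F l u p : (forall e, e \in F -> 0 <= l e) ->
  path (adj F) u p -> 0 <= walk_len l u p.
Proof.
move=> l0 pp; rewrite /walk_len big_seq; apply: sumr_ge0 => e.
by move=> /(mem_pairmap_edge pp)/l0.
Qed.

Lemma walk_len_potential F l (f : V -> R) u p :
  (forall x y, edge x y \in F -> f y - f x <= l (edge x y)) ->
  path (adj F) u p -> f (last u p) - f u <= walk_len l u p.
Proof.
move=> fl; elim: p u => [|v p IH] u /=; first by rewrite walk_len_nil subrr.
move=> /andP[/fl uv /IH vp]; rewrite walk_len_cons; lra.
Qed.

(** A distance bound carried by an explicit walk. It includes reachability, and it passes to larger
    edge sets, smaller lengths and concatenations without any handling of the infimum. *)
Definition within F l (x : R) u v :=
  exists p, [/\ path (adj F) u p, last u p = v & walk_len l u p <= x].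

Lemma within_path F l u p : path (adj F) u p ->
  within F l (walk_len l u p) u (last u p).
Proof. by exists p. Qed.

Lemma within_refl F l x u : 0 <= x -> within F l x u u.
Proof. by exists [::]; rewrite walk_len_nil. Qed.

Lemma within_edge F l u v : edge u v \in F -> within F l (l (edge u v)) u v.
Proof.
by move=> uv; exists [:: v]; rewrite walk_len_cons walk_len_nil addr0 /= /adj uv.
Qed.

Lemma within_trans F l x y u v w :
  within F l x u v -> within F l y v w -> within F l (x + y) u w.
Proof.
move=> [p [pp <- px]] [q [pq <- qy]]; exists (p ++ q).
by rewrite cat_path pp pq last_cat walk_len_cat lerD.
Qed.

Lemma within_sym F l x u v : within F l x u v -> within F l x v u.
Proof.
move=> [p [pp <- px]]; exists (rev (belast u p)).
rewrite walk_len_rev px rev_path (eq_path (e' := adj F)); last first.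
  by move=> a b; rewrite adjC.
split=> //; case: p {px} pp => [|w p] //= _.
by rewrite rev_cons last_rcons.
Qed.

Lemma within_le F l x y u v : x <= y -> within F l x u v -> within F l y u v.
Proof. by move=> xy [p [? ? px]]; exists p; split=> //; apply: le_trans xy. Qed.

Lemma within_sub F F' l x u v :
  F \subset F' -> within F l x u v -> within F' l x u v.
Proof.
move=> /subsetP FF' [p [pp ? ?]]; exists p; split=> //.
by apply: sub_path pp => a b; apply: FF'.
Qed.

Lemma within_len F l l' x u v : (forall e, e \in F -> l' e <= l e) ->
  within F l x u v -> within F l' x u v.
Proof.
move=> ll' [p [pp ? px]]; exists p; split=> //.
exact: le_trans (le_walk_len pp ll') px.
Qed.

Lemma within_connect F l x u v : within F l x u v -> connect (adj F) u v.
Proof. by move=> [p [pp lp _]]; apply/connectP; exists p. Qed.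

(* [dist G F] is convertible to [pdist F (len G)]. *)
Definition pdist F l u v : R := inf [set x : R | exists p : seq V,
    [/\ path (adj F) u p, last u p = v & x = walk_len l u p]]%classic.

Lemma pdist_le F l x u v : (forall e, e \in F -> 0 <= l e) ->
  within F l x u v -> pdist F l u v <= x.
Proof.
move=> l0 [p [pp lp px]]; apply: le_trans px; apply: ge_inf; last by exists p.
by exists 0 => _ [q [qp _ ->]]; apply: walk_len_ge0 qp.
Qed.

Lemma pdist_ge0 F l u v : (forall e, e \in F -> 0 <= l e) -> 0 <= pdist F l u v.
Proof.
move=> l0; rewrite /pdist; set A := (X in inf X).
have [->|/set0P A0] := eqVneq A classical_sets.set0; first by rewrite inf0.
by apply: lb_le_inf => // _ [p [pp _ ->]]; apply: walk_len_ge0 pp.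
Qed.

Lemma uniq_walk F l u p : (forall e, e \in F -> 0 <= l e) ->
  path (adj F) u p -> exists p', [/\ path (adj F) u p', last u p' = last u p,
    uniq (u :: p') & walk_len l u p' <= walk_len l u p].
Proof.
move=> l0; elim: p u => [|w p IH] u; first by exists [::].
move=> /= /andP[uw /IH[p' [pp' <- up' lp']]].
have uw0 := l0 _ uw; have [uIn|uNin] := boolP (u \in w :: p'); last first.
  by exists (w :: p'); rewrite !walk_len_cons lerD2l /= uw pp' -/(uniq (w :: p')) up' uNin.
move: uIn; rewrite in_cons => /predU1P[uEw|uIn].
  rewrite -uEw in pp' up' lp' uw0 *; exists p'; split=> //.
  by rewrite walk_len_cons; lra.
case/splitPr: uIn pp' up' lp' => a b; rewrite cat_path last_cat /=.
move=> /and3P[pa au pb]; rewrite mem_cat negb_or cat_uniq -andbA /=.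
move=> /and5P[_ _ _ _ ub]; rewrite walk_len_cat !walk_len_cons => lp.
exists b; split=> //.
have := walk_len_ge0 l0 pa.
have := l0 _ au; rewrite /adj in au *; lra.
Qed.

(** Excising closed detours never lengthens a walk, so the infimum may be taken over walks of at
    most [#|V|] steps. These form a finite type, on which a minimum exists. *)
Lemma pdist_attained F l u v : (forall e, e \in F -> 0 <= l e) ->
  connect (adj F) u v -> exists p,
  [/\ path (adj F) u p, last u p = v & walk_len l u p = pdist F l u v].
Proof.
move=> l0 /connectP[p0 p0P ->].
pose P (p : #|V|.-bseq V) := path (adj F) u p && (last u p == last u p0).
have bP p : path (adj F) u p -> last u p = last u p0 ->
    exists p' : #|V|.-bseq V, P p' /\ walk_len l u p' <= walk_len l u p.
  move=> pp lp; have [p' [pp' lp' up' wp']] := uniq_walk l0 pp.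
  have sp' : (size p' <= #|V|)%N.
    by move: up' => /= /andP[_ /card_uniqP <-]; apply: max_card.
  by exists (Bseq sp'); rewrite /P /= pp' lp' lp eqxx.
have [p1 [Pp1 _]] := bP _ p0P erefl.
case: (arg_minP (fun p : #|V|.-bseq V => walk_len l u p) Pp1) => p /andP[pp /eqP lp] pmin.
exists p; split=> //; apply/eqP; rewrite eq_le; apply/andP; split; last first.
  by apply: pdist_le => //; rewrite -lp; apply: within_path.
apply: lb_le_inf; first by exists (walk_len l u p); exists p.
move=> _ [q [pq lq ->]]; have [q' [Pq' wq']] := bP _ pq lq.
exact: le_trans (pmin _ Pq') wq'.
Qed.

Lemma within_pdist F l u v : (forall e, e \in F -> 0 <= l e) ->
  connect (adj F) u v -> within F l (pdist F l u v) u v.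
Proof.
by move=> l0 /(pdist_attained l0)[p [? ? <-]]; exists p.
Qed.

Lemma pdist_triangle F l u v w : (forall e, e \in F -> 0 <= l e) ->
  connect (adj F) u v -> connect (adj F) v w ->
  pdist F l u w <= pdist F l u v + pdist F l v w.
Proof.
move=> l0 uv vw; apply: pdist_le => //.
by apply: (within_trans (v := v)); apply: within_pdist.
Qed.

Lemma pdist_refl F l u : (forall e, e \in F -> 0 <= l e) -> pdist F l u u = 0.
Proof.
move=> l0; apply/eqP; rewrite eq_le pdist_ge0// andbT.
by apply: pdist_le => //; apply: within_refl.
Qed.

Lemma connect_adjC F u v : connect (adj F) u v = connect (adj F) v u.
Proof. exact: (sym_connect_sym (adjC F)). Qed.

Lemma pdist_edge F l u v : (forall e, e \in F -> 0 <= l e) ->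
  edge u v \in F -> pdist F l u v <= l (edge u v).
Proof. by move=> l0 uv; apply: pdist_le => //; apply: within_edge. Qed.

Definition induced F (Y : {set V}) : {set {set V}} := [set e in F | e \subset Y].

Lemma induced_subset F (Y Y' : {set V}) :
  Y \subset Y' -> induced F Y \subset induced F Y'.
Proof.
move=> YY'; apply/subsetP => e; rewrite !inE => /andP[-> eY].
exact: subset_trans YY'.
Qed.

Lemma edge_sub u v (Y : {set V}) : (edge u v \subset Y) = (u \in Y) && (v \in Y).
Proof. by rewrite /edge subUset !sub1set. Qed.

Lemma induced_edge F Y u v :
  (edge u v \in induced F Y) = [&& edge u v \in F, u \in Y & v \in Y].
Proof. by rewrite inE edge_sub. Qed.

Lemma path_induced F (Y : {set V}) u p : path (adj F) u p -> {subset u :: p <= Y} ->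
  path (adj (induced F Y)) u p.
Proof.
elim: p u => [|v p IH] u //= /andP[uv pp] sY.
rewrite IH // ?andbT; last by move=> w wp; apply: sY; rewrite inE wp orbT.
rewrite {1}/adj induced_edge; apply/and3P; split=> //.
  by apply: sY; rewrite inE eqxx.
by apply: sY; rewrite !inE eqxx orbT.
Qed.

End Walks.

(** * Region growing with a doubly logarithmic number of layers *)

Section RegionGrowing.
Context {R : realType} {V : finType}.
Implicit Types (F : {set {set V}}) (S : R -> {set V}) (A B Y : {set V}).

(** These are the edges cut by [A]: they meet [A] without lying inside it. *)
Definition separated A (e : {set V}) := ~~ (e \subset A) && ~~ [disjoint e & A].

Lemma card_le_diam N (P : {pred 'I_N}) (K : R) : 0 <= K ->
  (forall i j, i \in P -> j \in P -> (i <= j)%N -> (j - i)%N%:R <= K) ->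
  #|P|%:R <= K + 1.
Proof.
move=> K0 Pd; case: (pickP (mem P)) => [i0 i0P|P0]; last first.
  by rewrite eq_card0 //; lra.
case: (arg_minnP (fun i : 'I_N => i : nat) i0P) => i Pi imin.
case: (arg_maxnP (fun i : 'I_N => i : nat) i0P) => j Pj jmax.
have ij : (i <= j)%N by apply: imin.
have : (#|P| <= (j - i).+1)%N.
  rewrite -(size_iota i (j - i).+1) cardE -(size_map val); apply: uniq_leq_size.
    by rewrite map_inj_uniq ?enum_uniq //; apply: val_inj.
  move=> _ /mapP[k kP ->]; rewrite mem_enum in kP.
  by rewrite mem_iota imin //= addnS ltnS subnKC //; apply: jmax.
rewrite -(ler_nat R) => /le_trans; apply.
by rewrite -natr1 lerD2r Pd.
Qed.

(** A discrete substitute for integrating the cut over the threshold. An edge is cut only for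
    thresholds in a window of length at most [g e], so the average cut over [N] evenly spaced
    thresholds is bounded by the touched weight; [eta] absorbs the discretisation error. *)
Lemma averaging F (b g : {set V} -> R) S (s w eta : R) :
  (forall e, e \in F -> 0 <= b e) -> (forall e, e \in F -> 0 <= g e) ->
  (forall r r', r <= r' -> S r \subset S r') ->
  (forall e r, e \in F -> ~~ [disjoint e & S r] -> e \subset S (r + g e)) ->
  0 < w -> 0 < eta ->
  exists r, [/\ s <= r, r <= s + w &
    w * \sum_(e in F | separated (S r) e) b e <=
    \sum_(e in F | ~~ [disjoint e & S (s + w)]) b e * g e + eta].
Proof.
move=> b0 g0 Smono Slip w0 eta0.
pose B := \sum_(e in F) b e.
have B0 : 0 <= B by apply: sumr_ge0.
(* Counting grid points in a window costs one extra point per edge, in total [w * B / N]; this [N]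
   makes that less than [eta]. *)
pose N := (Num.bound (w * B / eta)).+1.
have N0 : 0 < N%:R :> R by rewrite ltr0n.
have NB : w * B < eta * N%:R.
  rewrite mulrC [eta * _]mulrC -ltr_pdivrMr // [B * w]mulrC.
  apply: lt_le_trans (archi_boundP _) _; last by rewrite ler_nat.
  by rewrite divr_ge0 ?mulr_ge0 // ltW.
pose r (i : 'I_N) : R := s + w * i%:R / N%:R.
have rle i : r i <= s + w.
  by rewrite lerD2l ler_pdivrMr // ler_pM2l // ler_nat ltnW.
have rge i : s <= r i by rewrite lerDl divr_ge0 ?mulr_ge0 // ltW.
set T := \sum_(e in F | _) _.
case: (pselect (exists i, w * \sum_(e in F | separated (S (r i)) e) b e <= T + eta)).
  by move=> [i ?]; exists (r i).
move=> nex; exfalso.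
have big i : T + eta <= w * \sum_(e in F | separated (S (r i)) e) b e.
  by rewrite leNgt; apply/negP => h; apply: nex; exists i; apply: ltW.
have : N%:R * (T + eta) <= w * \sum_(i < N) \sum_(e in F | separated (S (r i)) e) b e.
  rewrite mulr_sumr -[N in N%:R]card_ord -sumr_const mulr_suml.
  by apply: ler_sum => i _; rewrite mul1r.
have cnt e : e \in F -> #|[pred i | separated (S (r i)) e]|%:R <= g e * N%:R / w + 1.
  move=> eF; apply: card_le_diam; first by rewrite divr_ge0 ?mulr_ge0 ?g0 // ltW.
  (* Once [S (r i)] touches [e], every set from the threshold [r i + g e] on contains [e] and no
     longer cuts it. *)
  move=> i j; rewrite !inE => /andP[_ di] /andP[sj _] ij.
  have := Slip _ _ eF di; have [h|h] := leP (r i + g e) (r j).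
    by move=> /subset_trans/(_ (Smono _ _ h)) k; rewrite k in sj.
  move=> _; rewrite ler_pdivlMr // -ler_pdivrMr // natrB //.
  by move: h; rewrite /r; lra.
rewrite (exchange_big_dep (mem F)) /=; last by move=> i e _ /andP[].
move=> h.
have inner e : e \in F ->
    \sum_(i < N | (e \in F) && separated (S (r i)) e) b e =
    b e * #|[pred i | separated (S (r i)) e]|%:R.
  by move=> eF; rewrite mulr_natr -sumr_const; apply: eq_bigl => i; rewrite !inE eF.
rewrite (eq_bigr _ inner) in h.
have : w * \sum_(e in F) b e * #|[pred i | separated (S (r i)) e]|%:R <=
    N%:R * T + w * B.
  rewrite mulr_sumr /T big_mkcondr /= /B !mulr_sumr -big_split /=.
  apply: ler_sum => e eF; case: ifPn => [tch|/negPn dis]; last first.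
    rewrite eq_card0 ?mulr0 ?add0r ?mulr_ge0 ?b0 ?ltW //.
    move=> i; rewrite !inE; apply/negP => /andP[_ /negP]; apply.
    exact: disjointWr (Smono _ _ (rle i)) dis.
  have -> : N%:R * (b e * g e) + w * b e = w * (b e * (g e * N%:R / w + 1)).
    by field; rewrite gt_eqF.
  by rewrite ler_pM2l //; apply: ler_wpM2l; rewrite ?b0 ?cnt.
lra.
Qed.


Lemma log2M (x y : R) : 0 < x -> 0 < y -> log2 (x * y) = log2 x + log2 y.
Proof. by move=> x0 y0; rewrite /log2 lnM ?posrE // mulrDl. Qed.

Lemma log2V (x : R) : 0 < x -> log2 x^-1 = - log2 x.
Proof. by move=> x0; rewrite /log2 lnV ?posrE // mulNr. Qed.

Lemma ln2_gt0 : 0 < ln 2 :> R.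
Proof. by rewrite ln_gt0 // ltr1n. Qed.

Lemma log2X n : log2 (2 ^+ n) = n%:R :> R.
Proof. by rewrite /log2 lnXn // mulrnAl divff ?gt_eqF ?ln2_gt0. Qed.

Lemma ler_log2 (x y : R) : 0 < x -> x <= y -> log2 x <= log2 y.
Proof.
move=> x0 xy; rewrite ler_pM2r ?invr_gt0 ?ln2_gt0 // ler_ln ?posrE //.
exact: lt_le_trans xy.
Qed.

Lemma le_log2_pow n (x : R) : 2 ^+ n <= x -> n%:R <= log2 x.
Proof. by move=> nx; rewrite -log2X ler_log2 // exprn_gt0. Qed.

Lemma log2_ge0 (x : R) : 1 <= x -> 0 <= log2 x.
Proof. exact: (@le_log2_pow 0). Qed.

Definition mass (m : V -> R) A : R := \sum_(v in A) m v.

Lemma mass_subset (m : V -> R) A B : (forall v, 0 <= m v) -> A \subset B ->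
  mass m A <= mass m B.
Proof.
move=> m0 /setIidPr AB; rewrite /mass [leRHS](big_setID A) /= AB lerDl.
exact: sumr_ge0.
Qed.

(** Each edge that meets [A] is charged to one of its vertices in [A]. *)
Lemma touching_le_mass F (c : {set V} -> R) (m : V -> R) A :
  (forall e, e \in F -> 0 <= c e) ->
  (forall v, \sum_(e in F | v \in e) c e <= m v) ->
  \sum_(e in F | ~~ [disjoint e & A]) c e <= mass m A.
Proof.
move=> c0 cm.
have : \sum_(v in A) \sum_(e in F | v \in e) c e <= mass m A.
  by apply: ler_sum => v _.
apply: le_trans; rewrite (exchange_big_dep (mem F)) /=; last by move=> ? ? _ /andP[].
rewrite big_mkcondr; apply: ler_sum => e eF; case: ifPn => [|_]; last first.
  by apply: sumr_ge0 => v _; apply: c0.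
rewrite -setI_eq0 => /set0Pn[v]; rewrite inE => /andP[ve vA].
rewrite (bigD1 v) /= ?vA ?eF ?ve // lerDl.
by apply: sumr_ge0 => *; apply: c0.
Qed.

(* p is the first of L layers with mass at most M / 2^(2^(L-p)).  Between the
   layers p-1 and p the mass doubles at most 2^(L-p+1) times, which is at most
   2 log2 (M / mass); so some subinterval of length w / (L 2^(L-p+1)) sees at
   most one doubling, and an average threshold in it is good. *)
Lemma region_growing F (c l : {set V} -> R) (m : V -> R) (m0 : R) S
    (w : R) (L : nat) (M : R) :
  (forall e, e \in F -> 0 <= c e) -> (forall e, e \in F -> 0 < l e) ->
  (forall r r', r <= r' -> S r \subset S r') ->
  (forall e r, e \in F -> ~~ [disjoint e & S r] -> e \subset S (r + 4 * l e)) ->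
  0 < m0 -> (forall v, m0 <= m v) ->
  (forall v, \sum_(e in F | v \in e) c e <= m v) ->
  0 < w -> (0 < L)%N -> S 0 != set0 -> mass m (S w) <= M / 2 ->
  M <= m0 * 2 ^+ (2 ^ L) ->
  exists r, [/\ 0 <= r, r <= w &
    w * \sum_(e in F | separated (S r) e) c e / l e <=
    20 * L%:R * mass m (S r) * log2 (M / mass m (S r))].
Proof.
move=> c0 l0 Smono Slip m00 mm0 cm w0 L0 S0 SwM Mm0.
have m_ge0 v : 0 <= m v by apply: le_trans (mm0 v); apply: ltW.
have LR : 0 < L%:R :> R by rewrite ltr0n.
have mS r : 0 <= r -> m0 <= mass m (S r).
  move=> r0; apply: le_trans (mass_subset m_ge0 (Smono _ _ r0)).
  case/set0Pn: S0 => v vS; rewrite /mass (bigD1 v) //= -[leLHS]addr0 lerD //.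
  by apply: sumr_ge0.
pose rad p : R := w * p%:R / L%:R.
have rad0 p : 0 <= rad p by rewrite divr_ge0 ?mulr_ge0 // ltW.
pose small p := mass m (S (rad p)) <= M / 2 ^+ (2 ^ (L - p)).
have smallL : exists p, (0 < p)%N && small p.
  by exists L; rewrite L0 /small /rad mulfK ?gt_eqF // subnn expn0 expr1.
case: (ex_minnP smallL) => p /andP[p0 ps] pmin.
have pL : (p <= L)%N.
  apply: pmin; rewrite L0 /small /rad mulfK ?gt_eqF //.
  by rewrite subnn expn0 expr1.
have p1 : p = p.-1.+1 by rewrite prednK.
set k := (2 ^ (L - p).+1)%N.
have M0 : 0 < M by have := mS w (ltW w0); lra.
have prev : M / 2 ^+ k <= mass m (S (rad p.-1)).
  (* For [p = 1] the layer below has radius 0 and is not covered by the minimality of [p]; there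
     [k = 2 ^ L], and the hypothesis relating [M] to [m0] takes over. *)
  have [p10|p1n0] := posnP p.-1.
    apply: le_trans (mS _ (rad0 _)); rewrite ler_pdivrMr ?exprn_gt0 //.
    by rewrite /k p1 p10 -subSn -?p1 // subSS subn0.
  apply/ltW; rewrite ltNge; apply/negP => h.
  have : (p <= p.-1)%N.
    apply: pmin; rewrite p1n0 /small; apply: le_trans h _.
    by rewrite /k -subSn // p1 subSS.
  by rewrite leqNgt {2}p1 ltnSn.
pose s i : R := rad p.-1 + w / L%:R * i%:R / k%:R.
have k0 : 0 < k%:R :> R by rewrite ltr0n expn_gt0.
have s0 i : 0 <= s i by rewrite addr_ge0 // !(mulr_ge0, divr_ge0) // ltW.
have sk : s k = rad p.
  rewrite /s /rad mulfK ?gt_eqF // [in RHS]p1 -natr1.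
  by field; rewrite gt_eqF.
have [i ik dbl] : exists2 i, (i < k)%N & mass m (S (s i.+1)) <= 2 * mass m (S (s i)).
  apply: contrapT => nex.
  have grow i : (i <= k)%N -> 2 ^+ i * mass m (S (s 0%N)) <= mass m (S (s i)).
    elim: i => [|i IH] ik; first by rewrite mul1r.
    apply: (@le_trans _ _ (2 * mass m (S (s i)))).
      by rewrite exprS -mulrA ler_pM2l // IH // ltnW.
    by rewrite leNgt; apply/negP => h; apply: nex; exists i => //; apply: ltW.
  (* If all [k] subintervals more than doubled the mass, the last one would reach at least [M],
     whereas the layer [p] has mass strictly below [M]. *)
  have := grow k (leqnn _); rewrite sk /s mulr0 mul0r addr0.
  apply/negP; rewrite -ltNge; apply: le_lt_trans ps _.
  apply: (@lt_le_trans _ _ M).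
    rewrite ltr_pdivrMr ?exprn_gt0 // ltr_pMr // exprn_egt1 ?ltr1n //.
    by rewrite expn_eq0.
  by rewrite mulrC -ler_pdivrMr ?exprn_gt0.
have wi0 : 0 < w / L%:R / k%:R by rewrite !divr_gt0.
have sS : s i.+1 = s i + w / L%:R / k%:R.
  by rewrite /s -natr1; field; rewrite !gt_eqF.
have [r [sr rs rP]] := averaging (F := F) (b := fun e => c e / l e)
  (g := fun e => 4 * l e) (S := S) (s i)
  (fun e eF => divr_ge0 (c0 e eF) (ltW (l0 e eF)))
  (fun e eF => mulr_ge0 (ler0n R 4) (ltW (l0 e eF))) Smono Slip wi0 m00.
rewrite -sS in rs rP.
have rw : s i.+1 <= s k.
  rewrite lerD2l ler_pdivrMr // mulfVK ?gt_eqF // ler_pM2l ?divr_gt0 //.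
  by rewrite ler_nat.
have r0 : 0 <= r by apply: le_trans sr.
have mr0 : 0 < mass m (S r) by apply: lt_le_trans (mS _ r0).
exists r; split=> //.
  apply: le_trans rs (le_trans rw _); rewrite sk /rad ler_pdivrMr //.
  by rewrite ler_pM2l // ler_nat.
have tch : \sum_(e in F | ~~ [disjoint e & S (s i.+1)]) c e / l e * (4 * l e) <=
    4 * mass m (S (s i.+1)).
  apply: le_trans (ler_wpM2l _ (touching_le_mass (S (s i.+1)) c0 cm)) => //.
  rewrite mulr_sumr le_eqVlt; apply/orP; left; apply/eqP.
  apply: eq_bigr => e /andP[eF _]; field.
  by rewrite gt_eqF // l0.
have mi : mass m (S (s i)) <= mass m (S r) by apply: mass_subset => //; apply: Smono.
have klog : k%:R <= 2 * log2 (M / mass m (S r)).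
  rewrite /k expnS natrM ler_pM2l //; apply: le_log2_pow.
  rewrite ler_pdivlMr // mulrC -ler_pdivlMr ?exprn_gt0 //.
  apply: le_trans ps; apply: mass_subset => //; apply: Smono.
  by rewrite -sk (le_trans rs).
move: rP; set C := \sum_(e in F | separated _ _) _ => rP.
(* The factor 4 of the window [4 * l e] and one doubling give 8, and the averaging error [m0] is at
   most one further mass of [S r]. *)
have : w / L%:R / k%:R * C <= 10 * mass m (S r).
  have := mS _ r0; lra.
have -> : w / L%:R / k%:R * C = w * C / (L%:R * k%:R) by field; rewrite !gt_eqF.
rewrite ler_pdivrMr ?mulr_gt0 // => /le_trans; apply.
have -> : 10 * mass m (S r) * (L%:R * k%:R) = 10 * L%:R * mass m (S r) * k%:R by ring.
have -> : 20 * L%:R * mass m (S r) * log2 (M / mass m (S r)) =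
   10 * L%:R * mass m (S r) * (2 * log2 (M / mass m (S r))) by ring.
by rewrite ler_pM2l // !mulr_gt0.
Qed.

End RegionGrowing.

(** * Cuts paid for by a decrease of entropy *)

Section Cut.
Context {R : realType} {V : finType}.
Implicit Types (F : {set {set V}}) (A B Y : {set V}).

Definition entropy (m : V -> R) (m0 : R) A : R :=
  mass m A * log2 (mass m A / m0).

(** By additivity of the mass, the right side is the left side plus the corresponding term for
    [Y :\: A], which is nonnegative. The contributions of [m0] cancel. *)
Lemma entropy_split (m : V -> R) (m0 : R) Y A : A \subset Y -> 0 < m0 ->
  0 < mass m A -> 0 < mass m (Y :\: A) ->
  mass m A * log2 (mass m Y / mass m A) <=
    entropy m m0 Y - entropy m m0 A - entropy m m0 (Y :\: A).
Proof.
move=> AY m00 A0 B0; have YAB : mass m Y = mass m A + mass m (Y :\: A).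
  by rewrite {1}/mass (big_setID A) /= (setIidPr AY).
have Y0 : 0 < mass m Y by rewrite YAB addr_gt0.
have BY : 0 <= log2 (mass m Y / mass m (Y :\: A)).
  by rewrite log2_ge0 // ler_pdivlMr // mul1r YAB lerDr ltW.
have := mulr_ge0 (ltW B0) BY.
rewrite /entropy !log2M ?invr_gt0 // !log2V // YAB; lra.
Qed.

Lemma separatedC Y A (e : {set V}) : e \subset Y -> A \subset Y ->
  separated (Y :\: A) e = separated A e.
Proof.
move=> eY AY; rewrite /separated andbC; congr (~~ _ && ~~ _).
  rewrite -setI_eq0 setIDA (setIidPl eY) setD_eq0 //.
by rewrite subsetD eY.
Qed.

(** Region growing needs a side with at most half of the mass. At the midpoint of the window one
    side qualifies: either the superlevel set is grown downwards from [b], or its complement upwards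
    from [a]. Using only half of the window turns the constant 20 into 40. *)
Lemma good_cut F (c l : {set V} -> R) (m : V -> R) (m0 : R) Y (sg : V -> R)
    (a b : R) (L : nat) :
  (forall e, e \in F -> e \subset Y) ->
  (forall e, e \in F -> 0 <= c e) -> (forall e, e \in F -> 0 < l e) ->
  0 < m0 -> (forall v, m0 <= m v) ->
  (forall v, \sum_(e in F | v \in e) c e <= m v) ->
  (forall e u v, e \in F -> u \in e -> v \in e -> sg u - sg v <= 4 * l e) ->
  a < b -> (exists2 u, u \in Y & b <= sg u) -> (exists2 v, v \in Y & sg v < a) ->
  (0 < L)%N -> mass m Y <= m0 * 2 ^+ (2 ^ L) ->
  exists D, [/\ a <= D, D <= b &
    let A := [set z in Y | D <= sg z] in
    (b - a) * \sum_(e in F | separated A e) c e / l e <=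
    40 * L%:R * (entropy m m0 Y - entropy m m0 A - entropy m m0 (Y :\: A))].
Proof.
move=> FY c0 l0 m00 mm0 cm lip ab [u0 u0Y bu] [v0 v0Y va] L0 Mm0.
pose P D := [set z in Y | D <= sg z].
have PY D : P D \subset Y by apply/subsetP => z; rewrite inE => /andP[].
have m_ge0 v : 0 <= m v by apply: le_trans (mm0 v); apply: ltW.
have mass_gt0 v A : v \in A -> 0 < mass m A.
  move=> vA; rewrite /mass (bigD1 v) //= ltr_wpDr ?sumr_ge0 //.
  exact: lt_le_trans (mm0 v).
have PA D : D <= b -> 0 < mass m (P D).
  by move=> Db; apply: (mass_gt0 u0); rewrite inE u0Y (le_trans Db).
have PB D : a <= D -> 0 < mass m (Y :\: P D).
  move=> aD; apply: (mass_gt0 v0).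
  by rewrite !inE v0Y andbT /= -ltNge (lt_le_trans va).
pose w := (b - a) / 2.
have w0 : 0 < w by rewrite divr_gt0 // subr_gt0.
have LR : 0 <= L%:R :> R by rewrite ler0n.
have [half|half] := leP (mass m (P (b - w))) (mass m Y / 2).
  pose S r := P (b - r).
  have [] := @region_growing R V F c l m m0 S w L (mass m Y) => //.
  - move=> r r' rr; apply/subsetP => z; rewrite !inE => /andP[->] /=; lra.
  - move=> e r eF; rewrite -setI_eq0 => /set0Pn[v]; rewrite !inE => /and3P[ve vY vS].
    apply/subsetP => u ue; rewrite !inE (subsetP (FY _ eF)) //=.
    by have := lip _ _ _ eF ve ue; lra.
  - by apply/set0Pn; exists u0; rewrite !inE u0Y subr0.
  move=> r [r0 rw rP]; have Db : b - r <= b by lra.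
  have aD : a <= b - r by rewrite /w in rw; lra.
  exists (b - r); split=> //=; rewrite -/(P _).
  have := entropy_split (PY (b - r)) m00 (PA _ Db) (PB _ aD).
  rewrite -/(S r) => E; move: rP; rewrite /w.
  set C := \sum_(e in F | _) _; set x := mass _ _ * _ in E *.
  have := ler_wpM2l LR E; rewrite -!mulrA -/x; lra.
pose S r := Y :\: P (a + r).
have [] := @region_growing R V F c l m m0 S w L (mass m Y) => //.
- move=> r r' rr; apply/subsetP => z; rewrite !inE => /andP[+ zY].
  by rewrite zY /= -!ltNge; lra.
- move=> e r eF; rewrite -setI_eq0 => /set0Pn[v]; rewrite !inE => /and3P[ve].
  move=> + vY; rewrite vY /= -ltNge => vS.
  apply/subsetP => u ue; rewrite !inE (subsetP (FY _ eF)) //= andbT -ltNge.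
  by have := lip _ _ _ eF ue ve; lra.
- by apply/set0Pn; exists v0; rewrite !inE v0Y addr0 -ltNge va.
- have wE : a + w = b - w by rewrite /w; lra.
  have : mass m Y = mass m (P (b - w)) + mass m (S w).
    rewrite {1}/mass (big_setID (P (b - w))) /= (setIidPr (PY _)) /S.
    by rewrite wE.
  lra.
move=> r [r0 rw rP]; have aD : a <= a + r by lra.
have Db : a + r <= b by rewrite /w in rw; lra.
exists (a + r); split=> //=; rewrite -/(P _).
have SP : Y :\: S r = P (a + r) by rewrite /S setDDr setDv set0U (setIidPr (PY _)).
have := @entropy_split m m0 Y (S r) (subsetDl _ _) m00 (PB _ aD).
rewrite SP => /(_ (PA _ Db)) E; move: rP; rewrite /w.
have -> : \sum_(e in F | separated (S r) e) c e / l e =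
   \sum_(e in F | separated (P (a + r)) e) c e / l e.
  apply: eq_bigl => e; case: (boolP (e \in F)) => //= eF.
  exact: separatedC (FY _ eF) (PY _).
set C := \sum_(e in F | _) _; set x := mass _ _ * _ in E *.
have := ler_wpM2l LR E; rewrite -!mulrA -/x -/(S r); lra.
Qed.

End Cut.

(** * Petals around a shortest path *)

Section Petal.
Context {R : realType} {V : finType} (F : {set {set V}}) (l : {set V} -> R)
  (Y : {set V}) (x0 : V) (q : seq V).
Context (l0 : forall e, e \in F -> 0 <= l e) (FY : forall e, e \in F -> e \subset Y)
  (x0Y : x0 \in Y) (Fconn : forall z, z \in Y -> connect (adj F) x0 z)
  (qF : path (adj F) x0 q)
  (qgeo : walk_len l x0 q <= pdist F l x0 (last x0 q)).
Implicit Types (u v w z p x : V) (D : R).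

Local Notation d := (pdist F l).
Local Notation delta := (pdist F l x0).

(* [petal D] is the union, over the vertices p of the path q from x0 to t, of the
   cones {z | delta p + d p z - delta z <= (r - d p t) / 2} with r = delta t - D;
   a vertex p with delta p < D contributes nothing. *)
Definition sigma z : R :=
  \big[Num.max/0]_(p | p \in x0 :: q) (2 * delta z - delta p - 2 * d p z).

Definition petal D := [set z in Y | D <= sigma z].

Lemma Fconn2 u v : u \in Y -> v \in Y -> connect (adj F) u v.
Proof.
move=> uY vY; apply: connect_trans (Fconn vY).
by rewrite connect_adjC Fconn.
Qed.

Lemma adj_mem u v : edge u v \in F -> u \in Y /\ v \in Y.
Proof. by move=> /FY; rewrite edge_sub => /andP[]. Qed.

Lemma path_mem u (p : seq V) : u \in Y -> path (adj F) u p -> {subset u :: p <= Y}.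
Proof.
elim: p u => [|v p IH] u uY /=; first by move=> _ w; rewrite inE => /eqP->.
move=> /andP[/adj_mem[_ vY] /(IH _ vY) sY] w.
by rewrite in_cons => /predU1P[->//|/sY].
Qed.

Lemma d_tri u v w : u \in Y -> v \in Y -> w \in Y -> d u w <= d u v + d v w.
Proof. by move=> *; apply: pdist_triangle => //; apply: Fconn2. Qed.

Lemma d_step u v w : u \in Y -> edge v w \in F -> d u w <= d u v + l (edge v w).
Proof.
move=> uY vw; have [vY wY] := adj_mem vw.
by apply: le_trans (d_tri uY vY wY) _; rewrite lerD2l pdist_edge.
Qed.

Lemma q_mem p : p \in x0 :: q -> p \in Y.
Proof. exact: path_mem. Qed.

Lemma delta_x0 : delta x0 = 0.
Proof. exact: pdist_refl. Qed.

Lemma geodesic_mid u v (p : seq V) w : path (adj F) u p -> last u p = v ->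
  walk_len l u p = d u v -> w \in u :: p -> d u w + d w v <= d u v.
Proof.
move=> pp lp wp wIn; case/splitPl: wIn pp lp wp => a b la.
rewrite cat_path last_cat walk_len_cat la => /andP[pa pb] lb <-.
by apply: lerD; apply: pdist_le => //; [rewrite -la|rewrite -lb]; apply: within_path.
Qed.

Lemma geodesic_prefix (a b : seq V) : q = a ++ b -> walk_len l x0 a = delta (last x0 a).
Proof.
move=> qE; apply/eqP; rewrite eq_le; apply/andP; split; last first.
  apply: pdist_le => //; apply: within_path.
  by move: qF; rewrite qE cat_path => /andP[].
have := qgeo; rewrite qE walk_len_cat last_cat => h.
have pb : path (adj F) (last x0 a) b by move: qF; rewrite qE cat_path => /andP[].
have aY : last x0 a \in Y.
  by apply: q_mem; rewrite qE -cat_cons mem_cat mem_last.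
have bY : last (last x0 a) b \in Y by apply: (path_mem aY pb); apply: mem_last.
have := d_tri x0Y aY bY.
have := pdist_le l0 (within_path l pb); lra.
Qed.

(** Positivity of [D] rules out the default value 0 of the maximum in [sigma], so membership is
    witnessed by a cone centre on [q]. *)
Lemma petalP D z : 0 < D -> reflect
  (z \in Y /\ exists2 p, p \in x0 :: q & delta p + 2 * d p z + D <= 2 * delta z)
  (z \in petal D).
Proof.
move=> D0; rewrite inE; apply: (iffP andP) => -[zY].
  move=> /bigmax_geP[|[p pq pD]]; first lra.
  by split=> //; exists p => //; lra.
move=> [p pq pD]; split=> //; apply/bigmax_geP; right; exists p => //; lra.
Qed.

Lemma petal_sub D : petal D \subset Y.
Proof. by apply/subsetP => z; rewrite inE => /andP[]. Qed.

Lemma petal_far D z : 0 < D -> z \in petal D -> D <= delta z.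
Proof.
move=> D0 /(petalP _ D0)[zY [p pq pD]]; have := d_tri x0Y (q_mem pq) zY.
have := pdist_ge0 p z l0; have := pdist_ge0 x0 p l0; lra.
Qed.

(** Both [2 * delta] and [2 * d p] change by at most twice the length of the edge. *)
Lemma sigma_lip u v : edge u v \in F -> sigma u - sigma v <= 4 * l (edge u v).
Proof.
move=> uv; rewrite lerBlDr; have luv := l0 uv; have [uY vY] := adj_mem uv.
have s0 : 0 <= sigma v by apply: bigmax_ge_id.
apply: bigmax_le => [|p pq]; first lra.
have := @le_bigmax_cond _ _ _ 0 p _ (fun p => 2 * delta v - delta p - 2 * d p v) pq.
rewrite -/(sigma v).
have := d_step (q_mem pq) uv.
have := d_step (v := v) (w := u) x0Y; rewrite edgeC => /(_ uv); lra.
Qed.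

Lemma q_in_petal D p : 0 < D -> p \in x0 :: q -> D <= delta p -> p \in petal D.
Proof.
move=> D0 pq Dp; apply/petalP => //; split; first exact: q_mem.
by exists p => //; rewrite pdist_refl //; lra.
Qed.

(** Cones are closed under continuing a shortest path away from [x0]. Hence a shortest path from
    [x0] that entered the petal could not end outside it. *)
Lemma rest_reach D z : 0 < D -> z \in Y :\: petal D ->
  within (induced F (Y :\: petal D)) l (delta z) x0 z.
Proof.
move=> D0; rewrite inE => /andP[zD zY].
have [p [pp lp wp]] := pdist_attained l0 (Fconn zY).
exists p; split=> //; last by rewrite wp.
apply: path_induced => // w wIn; have wY := path_mem x0Y pp wIn.
rewrite inE wY andbT; apply: contra zD => /(petalP _ D0)[_ [r rq rD]].
apply/petalP => //; split=> //; exists r => //.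
have := geodesic_mid pp lp wp wIn.
have := d_tri (q_mem rq) wY zY; lra.
Qed.

(** By the triangle inequality, a cone contains every shortest path from its centre [p] to a member
    [z]; the length bound is the cone inequality solved for [d p z]. *)
Lemma petal_reach D z : 0 < D -> z \in petal D -> exists p,
  [/\ p \in x0 :: q, D <= delta p &
      within (induced F (petal D)) l (delta z - (delta p + D) / 2) p z].
Proof.
move=> D0 zP; have /(petalP _ D0)[zY [p pq pD]] := zP.
have pY := q_mem pq.
have Dp : D <= delta p by have := d_tri x0Y pY zY; lra.
exists p; split=> //; apply: (@within_le _ _ _ _ (d p z)); first lra.
have [r [rr lr wr]] := pdist_attained l0 (Fconn2 pY zY).
exists r; split=> //; last by rewrite wr.
apply: path_induced => // w wIn; have wY := path_mem pY rr wIn.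
apply/petalP => //; split=> //; exists p => //.
have := geodesic_mid rr lr wr wIn.
have := d_tri x0Y wY zY; lra.
Qed.

Lemma crossing (f : V -> R) D u (s : seq V) : f u < D -> D <= f (last u s) ->
  exists a x b, [/\ s = a ++ x :: b, f (last u a) < D & D <= f x].
Proof.
elim: s u => [|v s IH] u /= uD; first lra.
have [vD sD|Dv sD] := ltP (f v) D; last by exists [::], v, s.
by have [a [x [b [-> aD Dx]]]] := IH v vD sD; exists (v :: a), x, b.
Qed.

Lemma petal_split D : 0 < D -> D <= delta (last x0 q) -> exists q1 x q2,
  [/\ q = q1 ++ x :: q2, delta (last x0 q1) < D, D <= delta x,
   {subset x0 :: q1 <= Y :\: petal D} & {subset x :: q2 <= petal D}].
Proof.
move=> D0 Dq; have [||q1 [x [q2 [qE q1D Dx]]]] := @crossing delta D x0 q => //.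
  by rewrite delta_x0.
exists q1, x, q2; split=> //.
  move=> w wIn; have wq : w \in x0 :: q by rewrite qE -cat_cons mem_cat wIn.
  rewrite inE q_mem // andbT; apply/negP => /(petal_far D0) Dw.
  suff : delta w <= delta (last x0 q1) by lra.
  case/splitPl: wIn qE {q1D wq} => a b la qE.
  rewrite -(geodesic_prefix qE) walk_len_cat.
  rewrite -catA in qE; rewrite (geodesic_prefix qE) la lerDl.
  by apply: walk_len_ge0 l0 _; move: qF; rewrite qE !cat_path la => /and3P[].
move=> w wIn; apply: q_in_petal => //; first by rewrite qE -cat_cons mem_cat wIn orbT.
apply: le_trans Dx _; case/splitPl: wIn qE => a b la qE.
have qE1 : q = rcons q1 x ++ (a ++ b) by rewrite cat_rcons.
have qE2 : q = (rcons q1 x ++ a) ++ b by rewrite -catA cat_rcons.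
have := geodesic_prefix qE2; rewrite walk_len_cat (geodesic_prefix qE1).
rewrite last_cat !last_rcons la => <-; rewrite lerDl.
apply: walk_len_ge0 l0 _.
by move: qF; rewrite qE1 !cat_path last_rcons => /and3P[].
Qed.

Lemma petal_along D q1 x q2 p : q = q1 ++ x :: q2 ->
  {subset x :: q2 <= petal D} -> p \in x :: q2 ->
  exists a, [/\ path (adj (induced F (petal D))) x a, last x a = p,
    walk_len l x a = delta p - delta x &
    {subset pairmap (@edge V) x a <= pairmap (@edge V) x q2}].
Proof.
move=> qE sP pIn; case/splitPl: pIn qE sP => a b la qE sP; exists a.
have qE1 : q = rcons q1 x ++ (a ++ b) by rewrite cat_rcons.
have qE2 : q = (rcons q1 x ++ a) ++ b by rewrite -catA cat_rcons.
split=> //.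
- apply: path_induced; first by move: qF; rewrite qE1 !cat_path last_rcons => /and3P[].
  by move=> w wIn; apply: sP; rewrite -cat_cons mem_cat wIn.
- have := geodesic_prefix qE2; rewrite walk_len_cat (geodesic_prefix qE1).
  rewrite last_cat !last_rcons la; lra.
- by move=> e eIn; rewrite pairmap_cat mem_cat eIn.
Qed.

End Petal.

(** * Forests certified by a rank function *)

Section Layered.
Context {V : finType}.
Implicit Types (T : {set {set V}}) (rk : V -> nat) (u v x y r : V) (A B : {set V}).

Lemma edge_eq u v x y : edge u v = edge x y -> (u = x /\ v = y) \/ (u = y /\ v = x).
Proof.
rewrite /edge => uvxy.
have /set2P u_xy : u \in [set x; y] by rewrite -uvxy set21.
have /set2P v_xy : v \in [set x; y] by rewrite -uvxy set22.
have /set2P x_uv : x \in [set u; v] by rewrite uvxy set21.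
have /set2P y_uv : y \in [set u; v] by rewrite uvxy set22.
by intuition congruence.
Qed.

(* A layered edge set is a forest: on a cycle of length at least 3 a vertex of
   maximal rank has two distinct neighbours of rank at most its own. *)
Definition layered T r rk :=
  (forall v, adj T r v -> (rk r < rk v)%N) /\
  (forall v x y, adj T v x -> adj T v y ->
     (rk x <= rk v)%N -> (rk y <= rk v)%N -> x = y).

Lemma layered_acyclic T r rk : layered T r rk -> acyclic_graph T.
Proof.
move=> [_ lay] c /andP[cyc cu]; rewrite leqNgt; apply/negP => c3.
have [v0 v0c] : exists v0, v0 \in c by case: c c3 {cyc cu} => // a c _; exists a; rewrite mem_head.
case: (arg_maxnP rk v0c) => v vc vmax.
have [i vE] : exists i, nth v0 c i = v /\ (i < size c)%N.
  by exists (index v c); rewrite nth_index // index_mem.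
have [a [b [d rE]]] : exists a b d, rot i c = [:: v, a & rcons d b].
  have : size (rot i c) = size c by rewrite size_rot.
  rewrite /rot (drop_nth v0) ?vE.2 // vE.1 /=.
  set s := _ ++ _ => sz; have : (2 <= size s)%N by rewrite -ltnS; move: sz => /= ->.
  case: s {sz} => // a s; case/lastP: s => // s b _; exists a, b, s.
  by [].
have := cyc; rewrite -(rot_cycle i) rE /= rcons_path last_rcons => /andP[va].
move=> /andP[_ bv].
have mem w : w \in rot i c -> w \in c by rewrite mem_rot.
have : a = b.
  apply: (lay v) => //; first by rewrite adjC.
    by apply: vmax; apply: mem; rewrite rE !inE eqxx orbT.
  by apply: vmax; apply: mem; rewrite rE !inE mem_rcons mem_head !orbT.
by move=> ab; move: cu; rewrite -(rot_uniq i) rE /= ab mem_rcons mem_head /= andbF.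
Qed.

Lemma adj_sub T (F : {set {set V}}) u v : T \subset F -> adj T u v -> adj F u v.
Proof. by move=> /subsetP TF; apply: TF. Qed.

(** Ranks on the side of [A] are shifted above all ranks on the side of [B]. The new edge then goes
    upwards from [y], and [x], as the root of [T2], had no neighbour of rank at most its own
    before. *)
Lemma layered_join A B T1 T2 x0 x y rk1 rk2 :
  [disjoint A & B] -> T1 \subset induced T1 B -> T2 \subset induced T2 A ->
  x0 \in B -> y \in B -> x \in A -> layered T1 x0 rk1 -> layered T2 x rk2 ->
  exists rk, layered (edge y x |: (T1 :|: T2)) x0 rk.
Proof.
move=> AB T1B T2A x0B yB xA [root1 lay1] [root2 lay2].
have inB u v : adj T1 u v -> (u \in B) * (v \in B).
  by move=> /(adj_sub T1B); rewrite /adj induced_edge => /and3P[_ -> ->].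
have inA u v : adj T2 u v -> (u \in A) * (v \in A).
  by move=> /(adj_sub T2A); rewrite /adj induced_edge => /and3P[_ -> ->].
have BnA u : u \in B -> (u \in A) = false by apply: disjointFl.
pose K := (\max_v rk1 v).+1.
have Kmax u : (rk1 u < K)%N by rewrite ltnS; apply: leq_bigmax.
exists (fun v => if v \in A then K + rk2 v else rk1 v)%N.
have adjE u v : adj (edge y x |: (T1 :|: T2)) u v ->
    [\/ adj T1 u v, adj T2 u v, u = y /\ v = x | u = x /\ v = y].
  rewrite /adj !inE => /orP[/eqP/edge_eq[[-> ->]|[-> ->]]|/orP[]].
  - by apply: Or43.
  - by apply: Or44.
  - by apply: Or41.
  - by apply: Or42.
have xB : x \in B = false by apply: disjointFr AB xA.
split=> [v /adjE[x0v|/inA[]|[-> ->]|[x0x _]]|v u w /adjE uv /adjE vw].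
- by rewrite !BnA ?(inB _ _ x0v) // root1.
- by rewrite BnA.
- by rewrite BnA // xA ltn_addr.
- by rewrite x0x xB in x0B.
have KF w' : (K + rk2 x <= rk1 w')%N = false by rewrite leqNgt ltn_addr.
have [vA|/negbTE vA] := boolP (v \in A); last first.
  have nT2 w' : adj T2 v w' -> False by move=> /inA[]; rewrite vA.
  have nx : v = x -> False by move=> vx; rewrite vx xA in vA.
  case: uv => [vu|/nT2//|[_ ->]|[/nx//]]; rewrite ?xA ?KF //.
  case: vw => [vw|/nT2//|[_ ->]|[/nx//]]; rewrite ?xA ?KF //.
  by rewrite !BnA ?(inB _ _ vu) ?(inB _ _ vw) //; apply: lay1.
have nT1 w' : adj T1 v w' -> False by move=> /inB[/BnA]; rewrite vA.
have ny : v = y -> False by move=> vy; rewrite vy BnA in vA.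
have xF w' : v = x -> adj T2 v w' -> (K + rk2 w' <= K + rk2 v)%N = false.
  by move=> ->; rewrite leq_add2l leqNgt => /root2->.
case: uv => [/nT1//|vu|[/ny//]|[vx ->]]; case: vw => [/nT1//|vw|[/ny//]|[vx' ->]].
- by rewrite !(inA _ _ vu) !(inA _ _ vw) !leq_add2l; apply: lay2.
- by rewrite !(inA _ _ vu) xF.
- by rewrite !(inA _ _ vw) xF.
- by [].
Qed.

End Layered.

(** * Recursive construction of a tree of low weighted stretch *)

Section LowStretchTree.
Context {R : realType} {V : finType} (E : {set {set V}}) (c l : {set V} -> R)
  (m : V -> R) (m0 k : R) (L : nat).
Context (E2 : forall e, e \in E -> #|e| = 2%N)
  (c0 : forall e, e \in E -> 0 <= c e) (l0 : forall e, e \in E -> 0 < l e)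
  (m00 : 0 < m0) (mm0 : forall v, m0 <= m v)
  (cm : forall v, \sum_(e in E | v \in e) c e <= m v)
  (L0 : (0 < L)%N) (Mm0 : mass m [set: V] <= m0 * 2 ^+ (2 ^ L))
  (kL : k = 1280 * L%:R).
Implicit Types (e : {set V}) (T : {set {set V}}) (A B Y : {set V}) (u v w x y z r : V).

(** [b] bounds tree distances from the root and [s] those between endpoints of edges. Both are
    measured in the true lengths [l], even where the recursion works with halved ones. *)
Definition low_stretch_tree Y r (b : V -> R) T :=
  exists rk (s : {set V} -> R), [/\ T \subset induced E Y, layered T r rk,
    forall z, z \in Y -> within T l (b z) r z,
    forall u v, edge u v \in induced E Y -> within T l (s (edge u v)) u v &
    \sum_(e in induced E Y) c e / l e * s e <= k * entropy m m0 Y].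

(** An edge inside [A] or inside [Y :\: A] keeps its bound, and a cut edge is routed through [x0] at
    cost [2 * Delta], paid for by the entropy lost in the split. The bound [b1y] is kept apart from
    [b y] because a sharper one is available when [y] ends a highway. *)
Lemma low_stretch_tree_glue Y A x0 x y (b b2 : V -> R) (b1y Delta : R) T1 T2 :
  A \subset Y -> x0 \in Y :\: A -> y \in Y :\: A -> x \in A -> edge y x \in E ->
  (forall z, z \in Y -> b z <= Delta) ->
  low_stretch_tree (Y :\: A) x0 b T1 -> low_stretch_tree A x b2 T2 ->
  within T1 l b1y x0 y ->
  (forall z, z \in A -> b1y + l (edge y x) + b2 z <= b z) ->
  2 * Delta * \sum_(e in induced E Y | separated A e) c e / l e <=
    k * (entropy m m0 Y - entropy m m0 A - entropy m m0 (Y :\: A)) ->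
  low_stretch_tree Y x0 b (edge y x |: (T1 :|: T2)).
Proof.
move=> AY x0B yB xA yxE bD [rk1 [s1 [T1B lay1 bT1 sT1 cost1]]].
move=> [rk2 [s2 [T2A lay2 bT2 sT2 cost2]]] x0y b2P cut.
set T := _ |: _.
have TT1 : T1 \subset T by rewrite /T setUCA subsetUl.
have TT2 : T2 \subset T by rewrite /T setUA subsetUr.
have indT T' Z : T' \subset induced E Z -> T' \subset induced T' Z.
  move=> /subsetP T'Z; apply/subsetP => e eT'.
  by have := T'Z _ eT'; rewrite !inE eT' => /andP[].
have AB : [disjoint A & Y :\: A] by rewrite -setI_eq0 setIDA setIC -setIDA setDv setI0.
have [rk lay] := layered_join AB (indT _ _ T1B) (indT _ _ T2A) x0B yB xA lay1 lay2.
have bT z : z \in Y -> within T l (b z) x0 z.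
  move=> zY; have [zA|zA] := boolP (z \in A); last first.
    by apply: (within_sub TT1); apply: bT1; rewrite inE zA.
  apply: (within_le (b2P _ zA)); apply: (within_trans (v := x)).
    apply: (within_trans (v := y)); first exact: within_sub TT1 x0y.
    by apply: within_edge; rewrite setU11.
  exact: within_sub TT2 (bT2 _ zA).
pose s (e : {set V}) := if e \subset A then s2 e else if e \subset Y :\: A then s1 e else 2 * Delta.
exists rk, s; split=> //.
- apply/subsetP => e; rewrite !inE => /orP[/eqP->|/orP[/(subsetP T1B)|/(subsetP T2A)]].
  + by rewrite yxE edge_sub (subsetP AY _ xA) andbT; move: yB; rewrite inE => /andP[].
  + by rewrite inE => /andP[-> /subset_trans]; apply; apply: subsetDl.
  + by rewrite inE => /andP[-> /subset_trans]; apply.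
- move=> u v; rewrite inE => /andP[uvE uvY]; rewrite /s.
  case: ifP => uvA; first by apply: (within_sub TT2); apply: sT2; rewrite inE uvE.
  case: ifP => uvB; first by apply: (within_sub TT1); apply: sT1; rewrite inE uvE.
  move: uvY; rewrite edge_sub => /andP[uY vY].
  have := within_trans (within_sym (bT _ uY)) (bT _ vY); apply: within_le.
  have := bD _ uY; have := bD _ vY; lra.
have sepE (e : {set V}) : e \in induced E Y -> ~~ (e \subset A) ->
    (e \subset Y :\: A) = ~~ separated A e.
  rewrite inE => /andP[_ eY] eA; rewrite /separated eA /= negbK.
  by rewrite subsetD eY.
have -> : \sum_(e in induced E Y) c e / l e * s e =
    \sum_(e in induced E A) c e / l e * s2 e +
    (\sum_(e in induced E (Y :\: A)) c e / l e * s1 e +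
     \sum_(e in induced E Y | separated A e) c e / l e * (2 * Delta)).
  rewrite (bigID (fun e => e \subset A)) /=; congr (_ + _).
    apply: eq_big => [e|e /andP[_ eA]]; last by rewrite /s eA.
    rewrite !inE; case: (boolP (e \subset A)) => eA; rewrite ?andbF //.
    by rewrite (subset_trans eA AY) !andbT.
  rewrite (bigID (fun e => e \subset Y :\: A)) /=; congr (_ + _).
    apply: eq_big => [e|e /andP[/andP[_ /negbTE eA] eB]]; last by rewrite /s eA eB.
    rewrite !inE; case: (boolP (e \subset Y :\: A)) => eB; rewrite ?andbF //.
    rewrite !andbT (subset_trans eB (subsetDl _ _)) andbT.
    case: (boolP (e \in E)) => //= eE; apply/negP => eA.
    have /card_gt0P[v ve] : (0 < #|e|)%N by rewrite E2.
    by have := subsetP eB _ ve; rewrite inE (subsetP eA _ ve).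
  apply: eq_big => [e|e /andP[/andP[_ /negbTE eA] /negbTE eB]]; last by rewrite /s eA eB.
  case: (boolP (e \in induced E Y)) => //= eY.
  case: (boolP (e \subset A)) => /= eA; first by rewrite /separated eA.
  by rewrite sepE // negbK.
rewrite -mulr_suml.
have -> : k * entropy m m0 Y = k * entropy m m0 A + (k * entropy m m0 (Y :\: A) +
   k * (entropy m m0 Y - entropy m m0 A - entropy m m0 (Y :\: A))) by ring.
by rewrite lerD // lerD // mulrC.
Qed.

Lemma low_stretch_tree1 x : low_stretch_tree [set x] x (fun=> 0) set0.
Proof.
have noE e : (e \in induced E [set x]) = false.
  rewrite inE; apply/negP => /andP[/E2 e2 /subset_leq_card].
  by rewrite e2 cards1.
exists (fun=> 0%N), (fun=> 0); split.
- exact: sub0set.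
- by split=> [v|v a b]; rewrite /adj inE.
- by move=> z; rewrite inE => /eqP->; apply: within_refl.
- by move=> u v; rewrite noE.
have k0 : 0 <= k by rewrite kL; apply: mulr_ge0; apply: ler0n.
rewrite big_pred0 // /entropy /mass big_set1; apply: mulr_ge0 => //.
have mx : 0 < m x by apply: lt_le_trans (mm0 x).
apply: mulr_ge0; first exact: ltW.
by apply: log2_ge0; rewrite ler_pdivlMr // mul1r.
Qed.

Definition halve (p : seq {set V}) (e : {set V}) : R := if e \in p then l e / 2 else l e.

Lemma halve_bounds p e : e \in E -> l e / 2 <= halve p e <= l e.
Proof. by move=> /l0 le0; rewrite /halve; case: ifP => _; lra. Qed.


Lemma low_stretch_tree_le Y r b b' T : (forall z, z \in Y -> b z <= b' z) ->
  low_stretch_tree Y r b T -> low_stretch_tree Y r b' T.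
Proof.
move=> bb' [rk [s [TY lay bT sT cost]]]; exists rk, s; split=> // z zY.
exact: within_le (bb' _ zY) (bT _ zY).
Qed.

Lemma induced_induced A Y : A \subset Y -> induced (induced E Y) A = induced E A.
Proof.
move=> AY; apply/setP => e; rewrite !inE.
case: (boolP (e \subset A)) => eA; rewrite ?andbF //.
by rewrite (subset_trans eA AY) !andbT.
Qed.

(** A potential that increases by at most the length along each edge bounds every walk from below,
    so a walk that meets this bound is shortest. This certifies the highways of subclusters. *)
Lemma geodesic_of_potential (F : {set {set V}}) (l' : {set V} -> R) (f : V -> R) u (h : seq V) :
  (forall e, e \in F -> 0 <= l' e) -> path (adj F) u h ->
  (forall x y, edge x y \in F -> f y - f x <= l' (edge x y)) ->
  walk_len l' u h <= f (last u h) - f u ->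
  walk_len l' u h <= pdist F l' u (last u h).
Proof.
move=> l'0 uh fl le_h.
have [|p [pp lp <-]] := @pdist_attained _ _ F l' u (last u h) l'0.
  by apply/connectP; exists h.
by apply: le_trans le_h _; rewrite -lp; apply: (walk_len_potential fl).
Qed.

(** The good cut for the level function [sigma]: the end of [q] has level at least [b] and [x0] has
    level below [a]. *)
Lemma petal_cut Y x0 (lam : {set V} -> R) (q : seq V) (a b : R) :
  let F := induced E Y in
  (forall e, e \in F -> 0 <= lam e <= l e) -> x0 \in Y ->
  (forall z, z \in Y -> connect (adj F) x0 z) -> path (adj F) x0 q ->
  walk_len lam x0 q <= pdist F lam x0 (last x0 q) ->
  0 < a -> a < b -> b <= pdist F lam x0 (last x0 q) ->
  exists D, [/\ a <= D, D <= b &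
    let A := petal F lam Y x0 q D in
    (b - a) * \sum_(e in F | separated A e) c e / l e <=
    40 * L%:R * (entropy m m0 Y - entropy m m0 A - entropy m m0 (Y :\: A))].
Proof.
move=> F lamP x0Y conn qF qgeo a0 ab bq.
have FE e : e \in F -> e \in E by rewrite inE => /andP[].
have FY e : e \in F -> e \subset Y by rewrite inE => /andP[].
have lam0 e : e \in F -> 0 <= lam e by move=> /lamP/andP[].
have b0 : 0 < b by apply: lt_trans ab.
apply: (good_cut (m := m) (sg := sigma F lam x0 q)) => //.
- by move=> e /FE/c0.
- by move=> e /FE/l0.
- move=> v; apply: le_trans (cm v); rewrite [leRHS](bigID (mem F)) /=.
  rewrite (eq_bigl (fun e => [&& e \in E, v \in e & e \in F])); last first.
    by move=> e; case: (boolP (e \in F)) => [/FE->|]; rewrite ?andbT ?andbF.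
  rewrite (eq_bigl _ _ (fun e => andbA _ _ _)) lerDl.
  by apply: sumr_ge0 => e /andP[/andP[/c0]].
- move=> e u v eF ue ve; have /andP[_ lame] := lamP _ eF.
  have le0 := l0 (FE _ eF).
  have [<-|uv] := eqVneq u v; first lra.
  have eE : e = edge u v.
    apply/esym/eqP; rewrite eqEcard (E2 (FE _ eF)) cards2 uv andbT.
    by rewrite edge_sub ue.
  rewrite eE in eF lame *.
  have := sigma_lip lam0 FY x0Y conn qF eF; lra.
- exists (last x0 q).
    by apply: (path_mem FY x0Y qF); apply: mem_last.
  have := q_in_petal lam0 FY x0Y qF b0 (mem_last _ _) bq.
  by rewrite inE => /andP[].
- exists x0 => //; rewrite ltNge; apply/negP => h.
  have : x0 \in petal F lam Y x0 q a by rewrite inE x0Y.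
  move=> /(petal_far lam0 FY x0Y conn qF a0).
  by rewrite pdist_refl // leNgt a0.
- apply: le_trans Mm0; apply: mass_subset (subsetT _) => v.
  exact: le_trans (ltW m00) (mm0 v).
Qed.


(** The factor 2 on the highway only undoes the halving, whereas a general vertex is allowed 4. This
    sharper bound has to be carried along because it is spent when a petal is cut off the highway
    itself. *)
Lemma low_stretch_tree_exists n Y x0 (h : seq V) :
  (#|Y| <= n)%N -> x0 \in Y ->
  (forall z, z \in Y -> connect (adj (induced E Y)) x0 z) ->
  path (adj (induced E Y)) x0 h ->
  let lam := halve (pairmap (@edge V) x0 h) in
  let delta := pdist (induced E Y) lam x0 in
  walk_len lam x0 h <= delta (last x0 h) ->
  exists T, low_stretch_tree Y x0 (fun z => 4 * delta z) T /\
    within T l (2 * delta (last x0 h)) x0 (last x0 h).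
Proof.
elim: n Y x0 h => [|n IH] Y x0 h Yn x0Y conn hF lam delta hgeo.
  by move: Yn; rewrite leqn0 cards_eq0 => /eqP Y0; rewrite Y0 inE in x0Y.
set F := induced E Y in conn hF lam delta hgeo *.
have FE e : e \in F -> e \in E by rewrite inE => /andP[].
have FY e : e \in F -> e \subset Y by rewrite inE => /andP[].
have lamP e : e \in F -> l e / 2 <= lam e <= l e by move=> /FE; apply: halve_bounds.
have lam_gt0 e : e \in F -> 0 < lam e.
  by move=> eF; have := l0 (FE _ eF); have := lamP _ eF; lra.
have lam0 e : e \in F -> 0 <= lam e by move=> /lam_gt0/ltW.
have lam0l e : e \in F -> 0 <= lam e <= l e.
  by move=> eF; rewrite lam0 //; have /andP[] := lamP _ eF.
have delta0 z : 0 <= delta z by apply: pdist_ge0.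
have lastY p : path (adj F) x0 p -> last x0 p \in Y.
  by move=> pp; apply: (path_mem FY x0Y pp); apply: mem_last.
have [Y1|Y1] := eqVneq Y [set x0].
  have hx0 : last x0 h = x0 by apply/set1P; rewrite -Y1 lastY.
  exists set0; split; last by rewrite hx0; apply: within_refl; rewrite mulr_ge0.
  rewrite Y1; apply: low_stretch_tree_le (low_stretch_tree1 x0) => z _.
  by rewrite mulr_ge0.
case: (arg_maxP delta x0Y) => zm zmY zmax.
set Delta := delta zm in zmax.
have {}zmax z : z \in Y -> delta z <= Delta by apply: zmax.
have Delta0 : 0 < Delta.
  have [z zY zx0] : exists2 z, z \in Y & z != x0.
    apply: contrapT => nex; move/eqP: Y1; apply; apply/setP => z; rewrite inE.
    apply/idP/eqP => [zY|->//]; apply/eqP; apply: contrapT => /negP zx0.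
    by apply: nex; exists z.
  apply: lt_le_trans (zmax z zY).
  have [[|v p] [/= pp lp wp]] := pdist_attained lam0 (conn z zY).
    by rewrite lp eqxx in zx0.
  rewrite -/(delta z) in wp; rewrite -wp walk_len_cons.
  move: pp => /andP[/lam_gt0 ? pp]; apply: ltr_wpDr => //.
  exact: walk_len_ge0 lam0 pp.
have geo_mono p w : path (adj F) x0 p -> walk_len lam x0 p <= delta (last x0 p) ->
    w \in x0 :: p -> delta w <= delta (last x0 p).
  move=> pp pgeo wp.
  have pE : walk_len lam x0 p = delta (last x0 p).
    apply/eqP; rewrite eq_le pgeo; apply: pdist_le => //; exact: within_path.
  have := geodesic_mid lam0 pp erefl pE wp.
  have := pdist_ge0 w (last x0 p) lam0; rewrite -/delta; lra.
have deltaE x y : edge x y \in F -> delta y - delta x <= lam (edge x y).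
  by move=> xy; have := d_step lam0 FY conn x0Y xy; rewrite -/delta; lra.
have card_lt A : A \subset Y -> x0 \notin A -> A != set0 ->
    (#|A| <= n)%N /\ (#|Y :\: A| <= n)%N.
  move=> AY x0A A0; split; rewrite -ltnS; apply: leq_trans Yn; apply: proper_card.
    by apply/properP; split=> //; exists x0.
  case/set0Pn: A0 => v vA; apply/properP; split; first exact: subsetDl.
  by exists v; rewrite ?inE ?vA // (subsetP AY).
(* A cut edge costs at most [2 * (4 * Delta)], which is 32 window widths; with the 40 of the good
   cut this gives 1280. *)
have costP (a b : R) A : b - a = Delta / 4 ->
   (b - a) * \sum_(e in F | separated A e) c e / l e <=
    40 * L%:R * (entropy m m0 Y - entropy m m0 A - entropy m m0 (Y :\: A)) ->
   2 * (4 * Delta) * \sum_(e in F | separated A e) c e / l e <=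
    k * (entropy m m0 Y - entropy m m0 A - entropy m m0 (Y :\: A)).
  move=> -> h1; rewrite kL.
  set S := \sum_(e in F | _) _ in h1 *.
  set X := entropy m m0 Y - _ - _ in h1 *.
  have -> : 1280 * L%:R * X = 32 * (40 * L%:R * X) by ring.
  lra.
(* Recursion on the rest. Distances from [x0] do not grow there, so the bounds in terms of the old
   [delta] survive for any highway [h'] that remains in the rest and whose halving agrees with
   [lam]. *)
have restP q D h' : path (adj F) x0 q -> walk_len lam x0 q <= delta (last x0 q) ->
    0 < D -> D <= delta (last x0 q) ->
    let B := Y :\: petal F lam Y x0 q D in
    {subset x0 :: h' <= B} -> path (adj F) x0 h' ->
    {in induced E B, halve (pairmap (@edge V) x0 h') =1 lam} ->
    walk_len lam x0 h' <= delta (last x0 h') ->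
    exists T, low_stretch_tree B x0 (fun z => 4 * delta z) T /\
      within T l (2 * delta (last x0 h')) x0 (last x0 h').
  move=> qF qgeo D0 Dq B h'B h'F lamB h'geo.
  have BY : B \subset Y by apply: subsetDl.
  have BF : induced E B \subset F by apply: induced_subset.
  have hB e : e \in induced E B -> 0 <= halve (pairmap (@edge V) x0 h') e.
    by move=> eB; rewrite lamB // lam0 // (subsetP BF).
  have reachB z : z \in B -> within (induced E B) lam (delta z) x0 z.
    by move=> zB; rewrite -(induced_induced BY); apply: rest_reach.
  have h'B' : path (adj (induced E B)) x0 h'.
    by rewrite -(induced_induced BY); apply: path_induced.
  have pB z : z \in B -> pdist (induced E B) (halve (pairmap (@edge V) x0 h')) x0 z
      <= delta z.
    move=> zB; apply: pdist_le => //; apply: within_len (reachB _ zB) => e eB.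
    by rewrite lamB.
  have x0B : x0 \in B by apply: h'B; rewrite mem_head.
  have lastA : last x0 q \in petal F lam Y x0 q D.
    by apply: (q_in_petal lam0 FY x0Y qF) => //; apply: mem_last.
  have [||_ Bn] := card_lt _ (petal_sub F lam Y x0 q D).
  - by move: x0B; rewrite inE => /andP[].
  - by apply/set0Pn; exists (last x0 q).
  have [||T [T1 T2]] := IH B x0 h' Bn x0B _ h'B'.
  - by move=> z /reachB/within_connect.
  - apply: (geodesic_of_potential (f := delta)) => //.
      by move=> u v uv; rewrite lamB //; apply: deltaE; apply: (subsetP BF).
    by rewrite (eq_walk_len h'B' lamB) [X in _ - X]pdist_refl // subr0.
  exists T; split.
    by apply: low_stretch_tree_le T1 => z zB; rewrite ler_pM2l // pB.
  by apply: within_le T2; rewrite ler_pM2l // pB //; apply: h'B; apply: mem_last.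
(* From the portal [x], a vertex of the petal is reached by following [q] to a cone centre [p] and
   then staying in the cone of [p]. *)
have reachA q D q1 x q2 : path (adj F) x0 q ->
    walk_len lam x0 q <= delta (last x0 q) -> 0 < D ->
    let A := petal F lam Y x0 q D in
    q = q1 ++ x :: q2 -> {subset x0 :: q1 <= Y :\: A} -> {subset x :: q2 <= A} ->
    forall z, z \in A -> exists p a, [/\ path (adj (induced E A)) x a /\ last x a = p,
      walk_len lam x a = delta p - delta x,
      {subset pairmap (@edge V) x a <= pairmap (@edge V) x q2}, p \in Y &
      within (induced E A) lam (delta z - (delta p + D) / 2) p z].
  move=> qF qgeo D0 A qE q1B q2A z zA.
  have AY : A \subset Y by apply: petal_sub.
  have [p [pq Dp pz]] := petal_reach lam0 FY x0Y conn qF D0 zA.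
  have pA := q_in_petal lam0 FY x0Y qF D0 pq Dp.
  have pq2 : p \in x :: q2.
    move: pq; rewrite qE -cat_cons mem_cat => /orP[/q1B|//].
    by rewrite inE pA.
  have [a [aA la wa sa]] := petal_along lam0 FY x0Y conn qF qgeo qE q2A pq2.
  exists p, a; rewrite !(induced_induced AY) in pz aA *; split=> //.
  exact: (subsetP AY).
(* Recursion on the petal with root [x] and highway [q2], which the potential [f] certifies as a
   shortest path. *)
have petP q D q1 x q2 (f : V -> R) : path (adj F) x0 q ->
    walk_len lam x0 q <= delta (last x0 q) -> 0 < D ->
    let A := petal F lam Y x0 q D in let lam' := halve (pairmap (@edge V) x q2) in
    q = q1 ++ x :: q2 -> {subset x0 :: q1 <= Y :\: A} -> {subset x :: q2 <= A} ->
    (forall u v, edge u v \in induced E A -> f v - f u <= lam' (edge u v)) ->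
    walk_len lam' x q2 <= f (last x q2) - f x ->
    exists T, low_stretch_tree A x (fun z => 4 * pdist (induced E A) lam' x z) T /\
      within T l (2 * pdist (induced E A) lam' x (last x q2)) x (last x q2).
  move=> qF qgeo D0 A lam' qE q1B q2A fl fq.
  have AY : A \subset Y by apply: petal_sub.
  have xA : x \in A by apply: q2A; rewrite mem_head.
  have q2A' : path (adj (induced E A)) x q2.
    rewrite -(induced_induced AY); apply: path_induced => //.
    by move: qF; rewrite qE cat_path => /and3P[].
  have [||An _] := card_lt A AY.
  - by have := q1B _ (mem_head _ _); rewrite inE => /andP[].
  - by apply/set0Pn; exists x.
  apply: (IH A x q2 An xA) => //.
    move=> z /(reachA _ _ _ _ _ qF qgeo D0 qE q1B q2A)[p [a [[pa lp] _ _ _ pz]]].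
    apply: connect_trans (within_connect pz); apply/connectP; by exists a.
  apply: (geodesic_of_potential (f := f)) => // e.
  rewrite inE => /andP[eE _]; have := halve_bounds (pairmap (@edge V) x q2) eE.
  have := l0 eE; rewrite /lam'; lra.
have splitP q q1 x q2 : path (adj F) x0 q ->
    walk_len lam x0 q <= delta (last x0 q) -> q = q1 ++ x :: q2 ->
    [/\ edge (last x0 q1) x \in F, walk_len lam x0 q1 = delta (last x0 q1),
      delta x = delta (last x0 q1) + lam (edge (last x0 q1) x),
      walk_len lam x q2 = delta (last x q2) - delta x &
      path (adj F) x0 q1 /\ path (adj F) x q2].
  move=> qF qgeo qE; have pre := geodesic_prefix lam0 FY x0Y conn qF qgeo.
  have qE1 : q = rcons q1 x ++ q2 by rewrite cat_rcons.
  have w1 := pre _ _ qE; have w2 := pre _ _ qE1; have := pre q [::] (esym (cats0 q)).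
  move: w2; rewrite [in X in _ -> X -> _]qE1 walk_len_cat last_cat -cats1 walk_len_cat.
  rewrite last_cat /= walk_len_cons walk_len_nil addr0 w1.
  rewrite -/delta => w2 w3.
  move: qF; rewrite qE cat_path /= => /and3P[-> yx ->].
  by split=> //; lra.
have disj (A : {set V}) (s : seq V) e : e \in E -> e \subset s -> {subset s <= A} ->
    ~~ (e \subset Y :\: A).
  move=> eE es sA; have /card_gt0P[v ve] : (0 < #|e|)%N by rewrite E2.
  apply/negP => /subsetP/(_ _ ve); rewrite inE sA //.
  exact: (subsetP es).
have [tfar|tnear] := leP (3 / 4 * Delta) (delta (last x0 h)).
- have [|||D [aD Db cut]] := @petal_cut Y x0 lam h (Delta / 2) (3 / 4 * Delta)
    lam0l x0Y conn hF hgeo; try lra.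
  have D0 : 0 < D by lra.
  have Dh : D <= delta (last x0 h) by lra.
  have [h1 [x [h2 [hE yD Dx h1B h2A]]]] := petal_split lam0 FY x0Y conn hF hgeo D0 Dh.
  have [yxF wh1 dx wh2 [h1F h2F]] := splitP _ _ _ _ hF hgeo hE.
  move: cut h1B h2A; set A := petal F lam Y x0 h D => cut h1B h2A.
  set y := last x0 h1 in yD yxF wh1 dx.
  have AY : A \subset Y by apply: petal_sub.
  (* The highway splits into [h1] and [h2], and its edge [y x] belongs to neither side. On each side
     [lam] is therefore the halving along that side's own highway, and no edge is halved twice. *)
  have lamE : lam = halve (pairmap (@edge V) x0 h1 ++ edge y x :: pairmap (@edge V) x h2).
    by rewrite /lam hE pairmap_cat.
  have lamB : {in induced E (Y :\: A), halve (pairmap (@edge V) x0 h1) =1 lam}.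
    move=> e; rewrite inE => /andP[eE eB]; rewrite lamE /halve mem_cat in_cons.
    case: (e \in pairmap _ x0 h1) => //=.
    rewrite (negbTE (_ : e != _)); last first.
      apply: contraTneq eB => ->; rewrite edge_sub negb_and orbC inE.
      by rewrite h2A ?mem_head.
    case: (boolP (e \in _)) => //= /pairmap_edge_sub es.
    by have := disj A _ _ eE es h2A; rewrite eB.
  have lamA : {in induced E A, halve (pairmap (@edge V) x h2) =1 lam}.
    move=> e; rewrite inE => /andP[eE eA]; rewrite lamE /halve mem_cat in_cons.
    case: (e \in pairmap _ x h2); rewrite ?orbT //= orbF.
    rewrite (negbTE (_ : e != _)); last first.
      apply: contraTneq eA => ->; rewrite edge_sub negb_and.
      by have := h1B _ (mem_last _ _); rewrite inE => /andP[->].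
    case: (boolP (e \in _)) => //= /pairmap_edge_sub es.
    have := disj (Y :\: A) _ _ eE es h1B.
    by rewrite setDDr setDv set0U (setIidPr AY) eA.
  have [|T1 [tree1 t1]] := restP h D h1 hF hgeo D0 Dh h1B h1F lamB.
    by rewrite wh1.
  have h2A' : path (adj (induced E A)) x h2.
    by rewrite -(induced_induced AY); apply: path_induced.
  have [||T2 [tree2 t2]] := petP h D h1 x h2 delta hF hgeo D0 hE h1B h2A.
  + move=> u v uv; rewrite lamA //; apply: deltaE.
    exact: (subsetP (induced_subset E AY)).
  + by rewrite (eq_walk_len h2A' lamA) wh2.
  have lamA0 e : e \in induced E A -> 0 <= halve (pairmap (@edge V) x h2) e.
    by move=> eA; rewrite lamA // lam0 // (subsetP (induced_subset E AY)).
  have /andP[lyx _] := lamP _ yxF.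
  exists (edge y x |: (T1 :|: T2)); split; last first.
    have -> : last x0 h = last x h2 by rewrite hE last_cat.
    apply: (@within_le _ _ _ _ (2 * delta y + l (edge y x) +
      2 * pdist (induced E A) (halve (pairmap (@edge V) x h2)) x (last x h2))).
      (* Since [l (edge y x)] is at most twice its [lam], the first two terms are at most
         [2 * delta x], and [h2] contributes the rest. *)
      have := pdist_le lamA0 (within_path _ h2A').
      by rewrite (eq_walk_len h2A' lamA) wh2; lra.
    apply: (within_trans (v := x)); last by apply: within_sub t2; rewrite setUA subsetUr.
    apply: (within_trans (v := y)); first by apply: within_sub t1; rewrite setUCA subsetUl.
    by apply: within_edge; rewrite setU11.
  apply: (low_stretch_tree_glue AY _ _ _ (FE _ yxF) _ tree1 tree2 t1 _ (costP _ _ _ _ cut)).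
  + by apply: h1B; rewrite mem_head.
  + by apply: h1B; apply: mem_last.
  + by apply: h2A; rewrite mem_head.
  + by move=> z zY; rewrite ler_pM2l //; apply: zmax.
  + move=> z zA; have [p [a [[ap la] wa _ pY pz]]] :=
      reachA _ _ _ _ _ hF hgeo D0 hE h1B h2A z zA.
    have : pdist (induced E A) (halve (pairmap (@edge V) x h2)) x z <=
        delta p - delta x + (delta z - (delta p + D) / 2).
      apply: pdist_le => //; rewrite -wa -(eq_walk_len ap lamA).
      apply: (within_trans (v := p)); first by rewrite -la; apply: within_path.
      by apply: within_len pz => e eA; rewrite lamA.
    (* After substitution what remains is [delta p <= delta x + D]. It holds because [delta p] is at
       most [Delta], while [delta x] and [D] are at least [Delta / 2]; hence the choice of this
       window. *)
    by have := zmax p pY; lra.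
  + by field.
- have [q [qF lq wq]] := pdist_attained lam0 (conn zm zmY).
  have qgeo : walk_len lam x0 q <= delta (last x0 q) by rewrite lq wq.
  have [|||D [aD Db cut]] := @petal_cut Y x0 lam q (3 / 4 * Delta) Delta
    lam0l x0Y conn qF qgeo; try lra.
  have D0 : 0 < D by lra.
  have Dq : D <= delta (last x0 q) by rewrite lq.
  have [q1 [x [q2 [qE yD Dx q1B q2A]]]] := petal_split lam0 FY x0Y conn qF qgeo D0 Dq.
  have [yxF wq1 dx wq2 [q1F q2F]] := splitP _ _ _ _ qF qgeo qE.
  set A := petal F lam Y x0 q D in cut q1B q2A.
  set y := last x0 q1 in yD yxF wq1 dx.
  have AY : A \subset Y by apply: petal_sub.
  have hB : {subset x0 :: h <= Y :\: A}.
    move=> w wh; rewrite inE (path_mem FY x0Y hF wh) andbT; apply/negP.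
    move=> /(petal_far lam0 FY x0Y conn qF D0).
    by have := geo_mono _ _ hF hgeo wh; rewrite -/delta; lra.
  (* The old highway ends closer than [D] and lies in the rest, so all edges that touch the petal
     still have their full length and may be halved now. *)
  have lam_l e : e \in E -> ~~ (e \subset Y :\: A) -> lam e = l e.
    move=> eE eB; rewrite /lam /halve ifN //; apply: contra eB => /pairmap_edge_sub es.
    by apply: subset_trans es _; apply/subsetP.
  have lamA e : e \in induced E A -> lam e = l e.
    rewrite inE => /andP[eE eA]; apply: lam_l => //.
    have /card_gt0P[v ve] : (0 < #|e|)%N by rewrite E2.
    by apply/negP => /subsetP/(_ _ ve); rewrite inE (subsetP eA).
  have lamyx : lam (edge y x) = l (edge y x).
    apply: lam_l; first exact: FE.
    by rewrite edge_sub negb_and orbC inE q2A ?mem_head.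
  have [|T1 [tree1 t1]] := restP q D h qF qgeo D0 Dq hB hF _ hgeo; first by [].
  set lam' := halve (pairmap (@edge V) x q2).
  have lamA_F e : e \in induced E A -> e \in F by apply: (subsetP (induced_subset E AY)).
  have lam'P e : e \in induced E A -> lam e / 2 <= lam' e <= lam e.
    by move=> eA; rewrite lamA //; apply/halve_bounds/FE/lamA_F.
  have half a : path (adj (induced E A)) x a ->
      {subset pairmap (@edge V) x a <= pairmap (@edge V) x q2} ->
      walk_len lam' x a = walk_len lam x a / 2.
    move=> aA sa; rewrite /walk_len mulr_suml; apply: eq_big_seq => e ea.
    by rewrite /lam' /halve sa // lamA //; apply: mem_pairmap_edge ea.
  have q2A' : path (adj (induced E A)) x q2.
    by rewrite -(induced_induced AY); apply: path_induced.
  (* Inside the petal lengths shrink by at most a factor 2, and along [q2] by exactly 2, so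
     [delta / 2] is a tight potential. *)
  have [||T2 [tree2 t2]] := petP q D q1 x q2 (fun z => delta z / 2)
    qF qgeo D0 qE q1B q2A.
  + move=> u v uv; have /andP[+ _] := lam'P _ uv.
    by rewrite -/lam'; have := deltaE _ _ (lamA_F _ uv); lra.
  + by rewrite -/lam' half // wq2; lra.
  have lamA0 e : e \in induced E A -> 0 <= lam' e.
    by move=> eA; have := lam0 _ (lamA_F _ eA); have := lam'P _ eA; lra.
  exists (edge y x |: (T1 :|: T2)); split; last first.
    by apply: within_sub t1; rewrite setUCA subsetUl.
  have yB : y \in Y :\: A by apply: q1B; apply: mem_last.
  have t1y : within T1 l (4 * delta y) x0 y.
    by have [rk [s [_ _ + _ _]]] := tree1; apply.
  apply: (low_stretch_tree_glue AY _ yB _ (FE _ yxF) _ tree1 tree2 t1y _ (costP _ _ _ _ cut)).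
  + by apply: hB; rewrite mem_head.
  + by apply: q2A; rewrite mem_head.
  + by move=> z zY; rewrite ler_pM2l //; apply: zmax.
  + move=> z zA; have [p [a [[ap la] wa sa pY pz]]] :=
      reachA _ _ _ _ _ qF qgeo D0 qE q1B q2A z zA.
    have : pdist (induced E A) lam' x z <=
        (delta p - delta x) / 2 + (delta z - (delta p + D) / 2).
      apply: pdist_le => //; rewrite -wa -half //.
      apply: (within_trans (v := p)); first by rewrite -la; apply: within_path.
      by apply: within_len pz => e /lam'P/andP[].
    (* The halved stretch of [q] cancels [delta p], and the remaining inequality follows from
       [delta y < D]. *)
    by rewrite -lamyx; lra.
  + by field.
Qed.

End LowStretchTree.

(** * An approximate minimax theorem *)

Section Minimax.
Context {R : realType} {I J : finType} (A : {pred I}) (B : {pred J}) (a : I -> J -> R).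
Implicit Type P : {ffun I -> R}.

Definition mixed P := [/\ forall i, 0 <= P i, \sum_i P i = 1 &
  forall i, P i != 0 -> i \in A].

Definition payoff P j : R := \sum_i P i * a i j.

Lemma payoff_bound P j : mixed P -> `|payoff P j| <= \sum_i \sum_j `|a i j|.
Proof.
move=> [P0 P1 _]; apply: le_trans (ler_norm_sum _ _ _) _; apply: ler_sum => i _.
rewrite normrM ger0_norm //.
have Pi1 : P i <= 1 by rewrite -P1 (bigD1 i) //= lerDl sumr_ge0.
apply: (@le_trans _ _ (1 * `|a i j|)); first exact: ler_wpM2r.
by rewrite mul1r (bigD1 j) //= lerDl sumr_ge0.
Qed.

Lemma sqr_max0D (x y : R) :
  Num.max 0 (x + y) ^+ 2 <= Num.max 0 x ^+ 2 + 2 * Num.max 0 x * y + y ^+ 2.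
Proof. by rewrite !maxEle; case: ifP => xy; case: ifP => x0; nra. Qed.

(* Frank-Wolfe descent of the penalty sum_j max(0, payoff_j - K)^2: its gradient
   is the weight to which the hypothesis answers with a descent direction. *)
Lemma approx_minimax (K eps : R) : 0 < eps -> (exists i, i \in A) ->
  (forall c : J -> R, (forall j, 0 <= c j) -> 0 < \sum_(j in B) c j ->
    exists2 i, i \in A & \sum_(j in B) c j * a i j <= K * \sum_(j in B) c j) ->
  exists2 P, mixed P & forall j, j \in B -> payoff P j <= K + eps.
Proof.
move=> eps0 [i0 i0A] resp; apply: contrapT => nex.
pose pt i : {ffun I -> R} := [ffun i' => (i' == i)%:R].
have pt_mixed i : i \in A -> mixed (pt i).
  move=> iA; split=> [i'||i']; rewrite ?ffunE //.
    by rewrite (bigD1 i) //= ffunE eqxx big1 ?addr0 // => i' /negbTE ne; rewrite ffunE ne.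
  by have [->//|_] := eqVneq i' i; rewrite mulr0n eqxx.
pose pen P := \sum_(j in B) Num.max 0 (payoff P j - K) ^+ 2.
pose S := \sum_i \sum_j `|a i j|.
pose M := \sum_(j in B) (2 * S) ^+ 2.
have M0 : 0 <= M by apply: sumr_ge0 => j _; apply: sqr_ge0.
have g0 : 0 < eps ^+ 2 by rewrite exprn_gt0.
(* The step size is small enough that the quadratic error [eta ^+ 2 * M] is at most
   [eta * eps ^+ 2]. This eats at most half of the linear gain [2 * eta * pen P], as [pen P] is at
   least [eps ^+ 2] before the goal is reached. *)
pose eta := eps ^+ 2 / (M + eps ^+ 2).
have eta0 : 0 < eta by rewrite divr_gt0 // ltr_wpDl.
have eta1 : eta <= 1 by rewrite ler_pdivrMr ?ltr_wpDl // mul1r lerDr.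
have etaM : eta * M <= eps ^+ 2.
  by rewrite mulrAC ler_pdivrMr ?ltr_wpDl // ler_pM2l // lerDl ltW.
have descent P : mixed P -> exists2 P', mixed P' & pen P' <= pen P - eta * eps ^+ 2.
  move=> mP; have [j [jB jP]] : exists j, j \in B /\ K + eps < payoff P j.
    apply: contrapT => nj; apply: nex; exists P => // j jB.
    by rewrite leNgt; apply/negP => h; apply: nj; exists j.
  pose c j := Num.max 0 (payoff P j - K).
  have c0 j' : 0 <= c j' by rewrite le_max lexx.
  have cj : eps <= c j by rewrite le_max; apply/orP; right; lra.
  have penP : eps ^+ 2 <= pen P.
    rewrite /pen (bigD1 j) //= -[leLHS]addr0 lerD //.
      by rewrite lerXn2r ?nnegrE ?c0 // ltW.
    by apply: sumr_ge0 => j' _; apply: sqr_ge0.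
  have [|i iA iP] := resp c c0.
    rewrite (bigD1 j) //=; apply: ltr_wpDr; first by apply: sumr_ge0.
    exact: lt_le_trans cj.
  have [P0 P1 PA] := mP; have [Q0 Q1 QA] := pt_mixed i iA.
  pose P' := [ffun i' => (1 - eta) * P i' + eta * pt i i'].
  exists P'.
    split=> [i'||i'].
    - by rewrite ffunE addr_ge0 // mulr_ge0 // ?subr_ge0 // ltW.
    - rewrite (eq_bigr (fun i' => (1 - eta) * P i' + eta * pt i i')); last by move=> *; rewrite ffunE.
      by rewrite big_split /= -!mulr_sumr P1 Q1; lra.
    - rewrite ffunE; have [Pi|/PA//] := eqVneq (P i') 0.
      have [Qi|/QA//] := eqVneq (pt i i') 0.
      by rewrite Pi Qi !mulr0 addr0 eqxx.
  have payP' j' : payoff P' j' - K = (payoff P j' - K) + eta * (a i j' - payoff P j').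
    have -> : payoff P' j' = (1 - eta) * payoff P j' + eta * a i j'.
      have -> : a i j' = payoff (pt i) j'.
        rewrite /payoff (bigD1 i) //= ffunE eqxx mul1r big1 ?addr0 // => i' /negbTE ne.
        by rewrite ffunE ne mul0r.
      rewrite /payoff !mulr_sumr -big_split; apply: eq_bigr => i' _.
      by rewrite ffunE mulrDl !mulrA.
    by ring.
  have grad : \sum_(j in B) c j * (a i j - payoff P j) <= - pen P.
    rewrite (eq_bigr (fun j => (c j * a i j - K * c j) - c j ^+ 2)).
      by rewrite !sumrB -mulr_sumr -/(pen P) lerBlDr addNr subr_le0.
    move=> j' _; rewrite /c maxEle; case: ifP => _; ring.
  have quad : \sum_(j in B) (a i j - payoff P j) ^+ 2 <= M.
    apply: ler_sum => j' _; rewrite -[leLHS]real_normK ?num_real//.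
    rewrite lerXn2r ?nnegrE ?mulr_ge0 ?sumr_ge0 //.
      by move=> ? _; apply: sumr_ge0.
    apply: le_trans (ler_normB _ _) _.
    have := payoff_bound j' mP; rewrite -/S.
    suff : `|a i j'| <= S by lra.
    rewrite /S (bigD1 i) //= (bigD1 j') //= -addrA lerDl.
    by rewrite addr_ge0 ?sumr_ge0 // => ? _; apply: sumr_ge0.
  have : pen P' <= pen P + 2 * eta * \sum_(j in B) c j * (a i j - payoff P j) +
      eta ^+ 2 * \sum_(j in B) (a i j - payoff P j) ^+ 2.
    rewrite /pen !mulr_sumr -!big_split /=; apply: ler_sum => j' _.
    rewrite payP'; apply: le_trans (sqr_max0D _ _) _.
    rewrite -/(c j') le_eqVlt; apply/orP; left; apply/eqP; ring.
  have : 2 * eta * \sum_(j in B) c j * (a i j - payoff P j) <= 2 * eta * - pen P.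
    by rewrite ler_wpM2l // mulr_ge0 // ltW.
  have : eta ^+ 2 * \sum_(j in B) (a i j - payoff P j) ^+ 2 <= eta * eps ^+ 2.
    apply: (@le_trans _ _ (eta ^+ 2 * M)); first by rewrite ler_wpM2l ?sqr_ge0.
    by rewrite expr2 -mulrA ler_pM2l.
  have : eta * eps ^+ 2 <= eta * pen P by rewrite ler_pM2l.
  lra.
(* A fixed decrease per step would eventually make the nonnegative penalty negative. *)
have iter t : exists2 P, mixed P & pen P <= pen (pt i0) - t%:R * (eta * eps ^+ 2).
  elim: t => [|t [P mP penP]]; first by exists (pt i0); [exact: pt_mixed|rewrite mul0r subr0].
  by have [P' mP' penP'] := descent P mP; exists P' => //; rewrite -natr1; lra.
have d0 : 0 < eta * eps ^+ 2 by rewrite mulr_gt0.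
have pen0 P : 0 <= pen P by apply: sumr_ge0 => j _; apply: sqr_ge0.
have [P mP penP] := iter (Num.bound (pen (pt i0) / (eta * eps ^+ 2))).
have := archi_boundP (divr_ge0 (pen0 (pt i0)) (ltW d0)).
rewrite ltr_pdivrMr // => h.
by have := pen0 P; lra.
Qed.

End Minimax.

(** * From weighted trees to a distribution over spanning trees *)

Section Graphs.
Context {R : realType} {V : finType} (G : wgraph R V).
Local Notation E := (edges G).
Local Notation l := (len G).

Lemma len_ge0 e : e \in E -> 0 <= l e.
Proof. by move=> /len_gt0/ltW. Qed.

Lemma spanning_dist_le T x u v : spanning_tree G T -> within T l x u v ->
  dist G T u v <= x.
Proof.
by move=> [/subsetP TE _ _]; apply: pdist_le => e /TE/len_ge0.
Qed.

Lemma spanning_dist_ge0 T u v : spanning_tree G T -> 0 <= dist G T u v.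
Proof. by move=> [/subsetP TE _ _]; apply: pdist_ge0 => e /TE/len_ge0. Qed.

(** The maximum over the orderings of the endpoints makes the stretch a function of the unordered
    edge, which indexes the columns of the game. *)
Definition edge_stretch (T : {set {set V}}) (e : {set V}) : R :=
  (\big[Num.max/0]_(uv : V * V | edge uv.1 uv.2 == e) dist G T uv.1 uv.2) / l e.

Lemma low_weighted_stretch_tree (c : {set V} -> R) (L : nat) :
  (forall e, 0 <= c e) -> 0 < \sum_(e in E) c e ->
  (0 < L)%N -> (3 * #|V| <= 2 ^ (2 ^ L))%N ->
  exists2 T, spanning_tree G T &
    \sum_(e in E) c e * edge_stretch T e <=
    1280 * L%:R * (3 * log2 (3 * #|V|)%:R) * \sum_(e in E) c e.
Proof.
move=> c0 S0 L0 nL; set S := \sum_(e in E) c e in S0 *.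
have [x0 _] : exists x0 : V, x0 \in V.
  have [e eE _] : exists2 e, e \in E & true.
    apply: contrapT => nex; have : S = 0 by apply: big1 => e eE; case: nex; exists e.
    by move=> SE; rewrite SE ltxx in S0.
  have /card_gt0P[v _] : (0 < #|e|)%N by rewrite (card_edges eE).
  by exists v.
have n0 : 0 < #|V|%:R :> R by rewrite ltr0n; apply/card_gt0P; exists x0.
(* A uniform share [S / n] is added to the incident weight of each vertex. With every edge counted
   at both ends the total is [3 * S], and its ratio to the minimum [m0] is [3 * n], whatever the
   weights. *)
pose m0 := S / #|V|%:R.
pose m v := m0 + \sum_(e in E | v \in e) c e.
have m00 : 0 < m0 by rewrite divr_gt0.
have mm0 v : m0 <= m v by rewrite lerDl sumr_ge0.
have cm v : \sum_(e in E | v \in e) c e <= m v by rewrite lerDr ltW.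
have mT : mass m [set: V] = 3 * S.
  rewrite /mass big_split /= sumr_const cardsT -(mulr_natr m0) /m0 divfK ?gt_eqF //.
  rewrite (exchange_big_dep (mem E)) /=; last by move=> ? ? _ /andP[].
  have -> : \sum_(e in E) \sum_(v in [set: V] | (e \in E) && (v \in e)) c e =
      \sum_(e in E) 2 * c e.
    apply: eq_bigr => e eE; rewrite mulr_natl -(card_edges eE) -sumr_const.
    by apply: eq_bigl => v; rewrite inE eE.
  by rewrite -mulr_sumr -/S; lra.
have Mm0 : mass m [set: V] <= m0 * 2 ^+ (2 ^ L).
  rewrite mT /m0 mulrAC ler_pdivlMr // [leRHS]mulrC [leLHS]mulrAC ler_pM2r //.
  by rewrite -natrX -natrM ler_nat.
have ET : induced E [set: V] = E by apply/setP => e; rewrite inE subsetT andbT.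
have conn z : z \in [set: V] -> connect (adj (induced E [set: V])) x0 z.
  by rewrite ET => _; apply: edges_connected.
have [] := @low_stretch_tree_exists R V E c l m m0 (1280 * L%:R) L
  (@card_edges _ _ G) (fun e _ => c0 e) (@len_gt0 _ _ G) m00 mm0 cm L0 Mm0 erefl
  #|[set: V]| [set: V] x0 [::] (leqnn _) (in_setT _) conn isT.
  rewrite walk_len_nil; apply: pdist_ge0 => e; rewrite ET => eE.
  by have := halve_bounds (@len_gt0 _ _ G) (pairmap (@edge V) x0 [::]) eE;
    have := len_gt0 eE; lra.
move=> T [[rk [s [TE lay Tx0 Ts cost]]] _]; rewrite ET in TE Ts cost.
have Tconn u v : connect (adj T) u v.
  apply: (@connect_trans _ _ x0); first rewrite connect_adjC.
    by have /within_connect := Tx0 u (in_setT _).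
  by have /within_connect := Tx0 v (in_setT _).
have Tspan : spanning_tree G T by split=> //; apply: layered_acyclic lay.
exists T => //; apply: (@le_trans _ _ (1280 * L%:R * entropy m m0 [set: V])).
  apply: le_trans cost; apply: ler_sum => e eE; rewrite -mulrA; apply: ler_wpM2l => //.
  rewrite /edge_stretch mulrC ler_pM2l ?invr_gt0 ?len_gt0 //.
  have sT u v : edge u v = e -> dist G T u v <= s e.
    by move=> uv; apply: spanning_dist_le => //; rewrite -uv; apply: Ts; rewrite uv.
  apply: bigmax_le => [|uv /eqP/sT//].
  have /eqP/cards2P[u [v [_ uv]]] := card_edges eE.
  by apply: le_trans (sT u v _); rewrite ?spanning_dist_ge0 // uv.
rewrite /entropy mT /m0 le_eqVlt; apply/orP; left; apply/eqP.
have -> : 3 * S / (S / #|V|%:R) = (3 * #|V|)%:R.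
  by rewrite natrM; field; rewrite !gt_eqF.
by ring.
Qed.


(** The triangle inequality is applied in each tree and then averaged. An edge may be longer than
    the distance of its endpoints in [G], so the bound per edge length has to be carried along
    shortest paths. *)
Lemma expected_dist_walk (P : {ffun {set {set V}} -> R}) (K : R) u p :
  tree_distribution G P ->
  (forall x y, edge x y \in E -> \sum_T P T * dist G T x y <= K * l (edge x y)) ->
  path (adj E) u p -> \sum_T P T * dist G T u (last u p) <= K * walk_len l u p.
Proof.
move=> [P0 P1 Pspan] PK; elim: p u => [|v p IH] u /=.
  rewrite walk_len_nil mulr0 big1 // => T _.
  have [->|/Pspan[/subsetP TE _ _]] := eqVneq (P T) 0; first by rewrite mul0r.
  by rewrite [dist _ _ _ _]pdist_refl ?mulr0 // => e /TE/len_ge0.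
move=> /andP[/PK uv /IH vp]; rewrite walk_len_cons mulrDr.
apply: le_trans (lerD uv vp); rewrite -big_split /=; apply: ler_sum => T _.
have [->|/Pspan[/subsetP TE Tc _]] := eqVneq (P T) 0; first by rewrite !mul0r addr0.
by rewrite -mulrDr ler_wpM2l //; apply: pdist_triangle => // e /TE/len_ge0.
Qed.

Lemma max_stretch_le (P : {ffun {set {set V}} -> R}) (K : R) : 0 <= K ->
  tree_distribution G P ->
  (forall x y, edge x y \in E -> \sum_T P T * dist G T x y <= K * l (edge x y)) ->
  max_stretch G P <= K.
Proof.
move=> K0 Pd PK; apply: bigmax_le => // -[u v] /= uv; rewrite /expected_stretch.
under eq_bigr do rewrite mulrA; rewrite -mulr_suml.
have d0 : 0 <= dist G E u v by apply: pdist_ge0; exact: len_ge0.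
(* Division by zero yields 0, so this case needs only [0 <= K]. *)
have [->|dn] := eqVneq (dist G E u v) 0; first by rewrite invr0 mulr0.
rewrite ler_pdivrMr ?lt_def ?dn //.
have [p [pp lp wp]] := pdist_attained len_ge0 (edges_connected G u v).
rewrite -[dist _ _ _ _ in leRHS]wp -[in leLHS]lp.
exact: expected_dist_walk.
Qed.

Lemma stretch_distribution (L : nat) : (1 < #|V|)%N ->
  (0 < L)%N -> (3 * #|V| <= 2 ^ (2 ^ L))%N ->
  exists2 P, tree_distribution G P &
    max_stretch G P <= 1280 * L%:R * (3 * log2 (3 * #|V|)%:R) + 1.
Proof.
move=> n1 L0 nL; set K := 1280 * L%:R * _.
have K0 : 0 <= K.
  rewrite /K; apply: mulr_ge0; first by apply: mulr_ge0; apply: ler0n.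
  apply: mulr_ge0; first exact: ler0n.
  by apply: log2_ge0; rewrite ler1n muln_gt0 /=; apply: ltnW.
have resp (c : {set V} -> R) : (forall e, 0 <= c e) -> 0 < \sum_(e in E) c e ->
    exists2 T, T \in [pred T | `[< spanning_tree G T >]] &
    \sum_(e in E) c e * edge_stretch T e <= K * \sum_(e in E) c e.
  move=> c0 S0; have [T Tspan TP] := low_weighted_stretch_tree c0 S0 L0 nL.
  by exists T => //; rewrite inE; apply/asboolP.
have [e0 e0E] : exists e0, e0 \in E.
  have /card_gt1P[x [y [_ _ xy]]] := n1.
  have /connectP[[|z p] /=] := edges_connected G x y.
    by move=> _ yx; rewrite yx eqxx in xy.
  by move=> /andP[xz _] _; exists (edge x z).
have [|P [P0 P1 PA] PK] := @approx_minimax R _ _ _ _ edge_stretch K 1 ltr01 _ resp.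
  have [|T TA _] := resp (fun=> 1) (fun=> ler01).
    by rewrite (bigD1 e0) //= ltr_pwDl // sumr_ge0.
  by exists T.
have Pd : tree_distribution G P.
  by split=> // T /PA; rewrite inE => /asboolP.
exists P => //; apply: max_stretch_le => //; first by rewrite addr_ge0.
move=> x y xyE; have := PK _ xyE; rewrite -ler_pdivrMr ?len_gt0 //.
apply: le_trans; rewrite mulr_suml /payoff; apply: ler_sum => T _.
rewrite -mulrA; apply: ler_wpM2l => //; rewrite ler_pM2r ?invr_gt0 ?len_gt0 //.
exact: (@le_bigmax_cond _ _ _ 0 (x, y) _ (fun uv => dist G T uv.1 uv.2)).
Qed.

End Graphs.

(** * Logarithmic scales and the final bound *)

Lemma log2_scale (R : realType) (n : nat) : (16 <= n)%N -> exists L : nat,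
  [/\ (0 < L)%N, (3 * n <= 2 ^ (2 ^ L))%N, log2 (3 * n)%:R <= 2 * log2 n%:R :> R
    & L%:R <= 3 * log2 (log2 n%:R) :> R].
Proof.
move=> n16; set x := log2 n%:R : R.
have nR : 16 <= n%:R :> R by rewrite ler_nat.
have x4 : 4 <= x by apply: (@le_log2_pow _ 4); rewrite -natrX.
have y2 : 2 <= log2 x by apply: (@le_log2_pow _ 2); rewrite -natrX.
have xn : log2 (3 * n)%:R <= 2 * x :> R.
  have -> : 2 * x = log2 (n%:R * n%:R) by rewrite log2M ?ltr0n ?(leq_trans _ n16) // -/x; lra.
  apply: ler_log2; rewrite ?ltr0n ?muln_gt0 ?(leq_trans _ n16) //.
  by rewrite -natrM ler_nat leq_mul2r (leq_trans _ n16) ?orbT.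
pose a := up_log 2 (3 * n); have n3 : (1 < 3 * n)%N by rewrite (leq_trans (leq_trans _ n16)) // leq_pmull.
have a3 : (3 * n <= 2 ^ a)%N by apply: up_logP.
have a1 : (1 < a)%N.
  rewrite -(@ltn_exp2l 2) //; apply: leq_trans a3.
  by apply: leq_trans (leq_pmull n _) => //; apply: leq_trans n16.
have ax : a%:R <= 4 * x.
  have : a.-1%:R <= log2 (3 * n)%:R :> R.
    apply: le_log2_pow; rewrite -natrX ler_nat ltnW //.
    exact: up_log_gtn.
  have : a%:R = a.-1%:R + 1 :> R by rewrite natr1 prednK // ltnW.
  lra.
(* [L] is the iterated rounded-up logarithm of [3 * n]. Each rounding costs at most 1, which the
   lower bounds 4 and 2 on the single and double logarithm absorb. *)
pose L := up_log 2 a; exists L; split=> //.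
- by rewrite up_log_gt0.
- by apply: leq_trans a3 _; rewrite leq_exp2l // up_logP.
have Lpos : (0 < L)%N by rewrite up_log_gt0.
have : L.-1%:R <= log2 (4 * x).
  apply: le_log2_pow; apply: le_trans ax; rewrite -natrX ler_nat ltnW //.
  exact: up_log_gtn.
have -> : log2 (4 * x) = 2 + log2 x.
  have -> : 4 = 2 ^+ 2 :> R by rewrite -natrX.
  by rewrite log2M ?log2X ?exprn_gt0 //; lra.
have : L%:R = L.-1%:R + 1 :> R by rewrite natr1 prednK.
lra.
Qed.

Theorem theorem1 (R : realType) :
  exists C : R, 0 < C /\
    exists N : nat, forall n : nat, (N <= n)%N ->
      (stretch R n <=
        (C * log2 n%:R * log2 (log2 n%:R) * log2 (log2 (log2 n%:R)) ^+ 3)%:E)%E.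
Proof.
(* The 18 collects 3 from the total mass [3 * S], 3 from the bound on [L] and 2 from the logarithm
   of [3 * n]; the 1 pays for the error allowed in the minimax step. *)
exists (1280 * 18 + 1); split; first by apply: ltr_wpDl ltr01; apply: mulr_ge0; apply: ler0n.
exists 16 => n n16; apply: ge_ereal_sup => _ [V [G [Vn ->]]].
have [L [L0 nL xL yL]] := log2_scale R n16; rewrite -Vn in n16 nL xL yL *.
have [|P Pd PK] := stretch_distribution G _ L0 nL; first exact: leq_trans n16.
apply: (@le_trans _ _ (max_stretch G P)%:E); first by apply: ereal_inf_lbound; exists P.
rewrite lee_fin; apply: le_trans PK _.
set x := log2 #|V|%:R in xL yL *.
have nR : 16 <= #|V|%:R :> R by rewrite ler_nat.
have x4 : 4 <= x by apply: (@le_log2_pow _ 4); rewrite -natrX.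
have y2 : 2 <= log2 x by apply: (@le_log2_pow _ 2); rewrite -natrX.
(* From 16 vertices on the triple logarithm is at least 1, so the stronger bound without its cube
   suffices. *)
have z1 : 1 <= log2 (log2 x) ^+ 3.
  by apply: exprn_ege1; apply: (@le_log2_pow _ 1).
apply: (@le_trans _ _ ((1280 * 18 + 1) * x * log2 x)); last first.
  apply: (ler_peMr _ z1); apply: mulr_ge0; last lra.
  by apply: mulr_ge0; lra.
have : L%:R * log2 (3 * #|V|)%:R <= (3 * log2 x) * (2 * x).
  apply: ler_pM => //; apply: log2_ge0; rewrite ler1n muln_gt0 /=.
  exact: leq_trans n16.
have : 1 <= x * log2 x by nra.
lra.
Qed.
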